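(* There exist smooth functions $h,f:\mathbb R\to\mathbb R$ such that, on $M=\mathbb R\times\mathbb T^2=\mathbb R\times \mathbb S^1\times\mathbb S^1$ with coordinates $(r,x,y)$, the metric $$g=dr^2+e^{2h(r)}(dx^2+dy^2)$$ and the potential function $f=f(r)$ form an expanding gradient Ricci soliton, i.e. $$\mathrm{Ric}+\mathrm{Hess}\, f+\tfrac12 g=0 ,$$ with the following properties: (1) all sectional curvatures of $g$ satisfy $-\frac14<\mathrm{sec}<0$; (2) the soliton approaches the hyperbolic cusp expanding soliton on one end, precisely: $h(r)\sim \frac r2$ and $f(r)$ converges to a constant as $r\to-\infty$; (3) the soliton approaches locally the flat Gaussian expanding soliton on a cone on the other end, precisely: $h(r)\sim\ln r$ and $f(r)\sim-\frac{r^2}{4}$ as $r\to+\infty$.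
   Context: A gradient Ricci soliton is a smooth Riemannian metric $g$ on a manifold $M$ together with a smooth potential function $f:M\to\mathbb R$ such that $\mathrm{Ric}+\mathrm{Hess}\, f+\frac{\epsilon}{2}g=0$ for some $\epsilon\in\mathbb R$; it is called expanding when $\epsilon>0$, and $\epsilon$ is then normalized to $\epsilon=1$. Here $\mathbb S^1$ is a circle (a quotient of $\mathbb R$ by a nontrivial discrete group of translations) and $x,y$ are its standard coordinates, so $dx^2+dy^2$ is a flat metric on $\mathbb T^2$. Notation: $\phi(r)\sim\psi(r)$ as $r\to\pm\infty$ means $\lim_{r\to\pm\infty}\phi(r)/\psi(r)=1$. *)

(* Defs.v *)
From Stdlib Require Import Reals List Lra.
From Coquelicot Require Import Coquelicot.
Open Scope R_scope.

(** Tensor calculus on [M = R x S^1 x S^1] in the coordinates [(r, x, y)].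

    With [S^1 = R / G] for a group [G] of translations, [M] is the quotient of
    [R^3] by [{0} x G x G].  A function on [M] is represented by its lift to
    [R^3], i.e. by a function on [R^3] invariant under that group.  As the
    vector fields [d/dr, d/dx, d/dy] descend to [M], a tensor field on [M] is
    represented by the lifts of its components in this global frame. *)

Definition point : Type := (R * R * R)%type.

Inductive coord : Set := Cr | Cx | Cy.

Definition get (i : coord) (p : point) : R :=
  let '(r, x, y) := p in
  match i with Cr => r | Cx => x | Cy => y end.

Definition set_coord (i : coord) (s : R) (p : point) : point :=
  let '(r, x, y) := p in
  match i with Cr => (s, x, y) | Cx => (r, s, y) | Cy => (r, x, s) end.

Definition sum3 (F : coord -> R) : R := F Cr + F Cx + F Cy.

Definition circle_group (G : R -> Prop) : Prop :=
  (G 0 /\ (forall s t, G s -> G t -> G (s - t))) /\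
  (exists t, G t /\ t <> 0) /\
  (exists e, 0 < e /\ forall t, G t -> t <> 0 -> e <= Rabs t).

Definition descends (G : R -> Prop) (u : point -> R) : Prop :=
  forall r x y s t, G s -> G t -> u (r, x + s, y + t) = u (r, x, y).

Definition smooth (phi : R -> R) : Prop :=
  forall (n : nat) (t : R), ex_derive_n phi n t.

Definition ex_pd (i : coord) (u : point -> R) (p : point) : Prop :=
  ex_derive (fun s => u (set_coord i s p)) (get i p).

Definition pd (i : coord) (u : point -> R) (p : point) : R :=
  Derive (fun s => u (set_coord i s p)) (get i p).

(** All iterated partial derivatives exist and are (jointly) continuous. *)
Definition smooth3 (u : point -> R) : Prop :=
  forall (l : list coord) (p : point),
    continuous (fold_right pd u l) p /\
    forall i, ex_pd i (fold_right pd u l) p.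

Definition smooth_on (G : R -> Prop) (u : point -> R) : Prop :=
  smooth3 u /\ descends G u.

Definition vector : Type := coord -> R.

(** [g i j p] is the component [g_ij] at [p]. *)
Definition tensor2 : Type := coord -> coord -> point -> R.

Definition eval2 (g : tensor2) (p : point) (u v : vector) : R :=
  sum3 (fun i => sum3 (fun j => g i j p * u i * v j)).

Definition riemannian_metric (G : R -> Prop) (g : tensor2) : Prop :=
  (forall i j, smooth_on G (g i j)) /\
  (forall i j p, g i j p = g j i p) /\
  (forall p (u : vector), (exists i, u i <> 0) -> 0 < eval2 g p u u).

(** The inverse matrix [g^ij], by Cramer's rule; taking the other two indices
    in cyclic order absorbs the signs of the cofactors. *)
Definition next (i : coord) : coord :=
  match i with Cr => Cx | Cx => Cy | Cy => Cr end.

Definition cofactor (g : tensor2) (i j : coord) (p : point) : R :=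
  g (next i) (next j) p * g (next (next i)) (next (next j)) p
  - g (next i) (next (next j)) p * g (next (next i)) (next j) p.

Definition det (g : tensor2) (p : point) : R :=
  sum3 (fun j => g Cr j p * cofactor g Cr j p).

Definition inverse (g : tensor2) : tensor2 :=
  fun i j p => cofactor g j i p / det g p.

Lemma inverse_correct (g : tensor2) (i k : coord) (p : point) :
  det g p <> 0 ->
  sum3 (fun j => g i j p * inverse g j k p) =
  match i, k with
  | Cr, Cr | Cx, Cx | Cy, Cy => 1
  | _, _ => 0
  end.
Proof.
unfold inverse; intros Hd; unfold sum3.
destruct i, k; unfold det, sum3, cofactor, next in *; field; exact Hd.
Qed.

(** [christoffel g k i j] is [Gamma^k_ij] of the Levi-Civita connection. *)
Definition christoffel (g : tensor2) (k i j : coord) (p : point) : R :=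
  / 2 * sum3 (fun l => inverse g k l p *
    (pd i (g j l) p + pd j (g i l) p - pd l (g i j) p)).

(** [riemann g l i j k] is the component along [d_l] of [R(d_i, d_j) d_k], with
    [R(X, Y) Z = D_X D_Y Z - D_Y D_X Z - D_[X,Y] Z]. *)
Definition riemann (g : tensor2) (l i j k : coord) (p : point) : R :=
  pd i (christoffel g l j k) p - pd j (christoffel g l i k) p
  + sum3 (fun m => christoffel g l i m p * christoffel g m j k p
                   - christoffel g l j m p * christoffel g m i k p).

(** [Ric(Y, Z)] is the trace of [X |-> R(X, Y) Z]. *)
Definition ricci (g : tensor2) : tensor2 :=
  fun j k p => sum3 (fun i => riemann g i i j k p).

Definition hessian (g : tensor2) (u : point -> R) : tensor2 :=
  fun i j p => pd i (pd j u) p - sum3 (fun k => christoffel g k i j p * pd k u p).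

Definition curvature (g : tensor2) (p : point) (u v w : vector) : vector :=
  fun l => sum3 (fun i => sum3 (fun j => sum3 (fun k =>
    riemann g l i j k p * u i * v j * w k))).

Definition independent (u v : vector) : Prop :=
  forall a b, (forall i, a * u i + b * v i = 0) -> a = 0 /\ b = 0.

(** Meaningful when [independent u v]: the sectional curvature of the plane
    spanned by [u] and [v]. *)
Definition sec (g : tensor2) (p : point) (u v : vector) : R :=
  eval2 g p (curvature g p u v v) u /
  (eval2 g p u u * eval2 g p v v - (eval2 g p u v)^2).

Definition gradient_ricci_soliton (G : R -> Prop) (eps : R)
    (g : tensor2) (u : point -> R) : Prop :=
  riemannian_metric G g /\ smooth_on G u /\
  forall i j p, ricci g i j p + hessian g u i j p + eps / 2 * g i j p = 0.

(** The normalization of the constant of an expanding soliton is [eps = 1]. *)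
Definition expanding_soliton (G : R -> Prop) : tensor2 -> (point -> R) -> Prop :=
  gradient_ricci_soliton G 1.

(** [dr^2 + e^(2 h(r)) (dx^2 + dy^2)] *)
Definition warped_metric (h : R -> R) : tensor2 := fun i j p =>
  match i, j with
  | Cr, Cr => 1
  | Cx, Cx | Cy, Cy => exp (2 * h (get Cr p))
  | _, _ => 0
  end.

Definition radial (phi : R -> R) : point -> R := fun p => phi (get Cr p).

Definition equivalent_at (phi psi : R -> R) (a : Rbar) : Prop :=
  is_lim (fun r => phi r / psi r) a 1.

(* Main.v *)
Require Import Defs.
From Stdlib Require Import Reals List Lra IndefiniteDescription FunctionalExtensionality.
From Coquelicot Require Import Coquelicot.
Open Scope R_scope.

(** For a warped product the soliton equation is a system of two ordinary
    differential equations, which in the variables [H = h'] and [P = 2 h' - f']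
    reads
[[
    H' = 1/2 - H P,    P' = 1/2 - 2 H^2.
]]
    The hyperbolic cusp is the fixed point [(1/2, 1)].  It is a saddle, and the
    required soliton is the branch of its unstable manifold along which [H]
    decreases and [P] increases.

    Existence.  Put [a = 1/2 - H] and [q = P - 1], so that
    [a' = q/2 - (1 + q) a] and [q' = 2 a - 2 a^2], and let [lambda] be the
    unstable eigenvalue.  Given [a], integrate the second equation to get [q];
    with this [q], solve the first one, which is linear, for a new [a].  Both
    are solved from minus infinity, [decaying_solution].  In the
    class of functions [a] with values between [0] and [1/2] and
    [a = exp (lambda t) + O (exp (2 lambda t))], this iteration contracts the
    distance weighted by [exp (2 lambda t)], [soliton_step_contracts].  The weight
    lives on the whole line, so the fixed point is at once a global solution, and
    the prescribed leading term makes it differ from the stationary one.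

    Curvature.  The sectional curvatures are averages of [- H^2] and of
    [- (H' + H^2) = Q - 1/2], where [Q = H (P - H)].  Comparison arguments
    starting at the cusp give [0 < H < 1/2] and, from
    [Q' = (P - H) (1/2 - Q) - H^3], also [1/4 < Q < 1/2], [Q_bounds].

    The conical end.  As [a] is bounded below on the positive half-line, [P] grows
    linearly; then [H P < 3/4] forces [H -> 0], the equation for [Q] forces
    [Q -> 1/2], and therefore [H P -> 1/2].  As [P' -> 1/2], L'Hopital's rule gives
    [P ~ t / 2], so [h' = H ~ 1 / t] and [f' = 2 H - P ~ - t / 2]; a second
    application gives the behaviour of [h] and [f]. *)

(** * Linear equations solved from minus infinity *)

Lemma continuous_of_derive (u : R -> R) (t l : R) :
  is_derive u t l -> continuous u t.
Proof.
intros H; apply (@ex_derive_continuous R_AbsRing R_NormedModule).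
now exists l.
Qed.

Lemma nondecreasing_of_derive (u u' : R -> R) (s t : R) :
  s <= t -> (forall x, s <= x <= t -> is_derive u x (u' x)) ->
  (forall x, s <= x <= t -> 0 <= u' x) -> u s <= u t.
Proof.
intros Hst Hd Hp.
destruct (MVT_gen u s t u') as [c [Hc E]];
  rewrite ?(Rmin_left s t), ?(Rmax_right s t) in * by lra.
- intros x Hx; apply Hd; lra.
- intros x Hx; apply continuity_pt_filterlim.
  apply (continuous_of_derive u x (u' x)), Hd; lra.
- specialize (Hp c Hc); nra.
Qed.

Lemma nonincreasing_of_derive (u u' : R -> R) (s t : R) :
  s <= t -> (forall x, s <= x <= t -> is_derive u x (u' x)) ->
  (forall x, s <= x <= t -> u' x <= 0) -> u t <= u s.
Proof.
intros Hst Hd Hp.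
enough (- u s <= - u t) by lra.
apply (nondecreasing_of_derive (fun x => - u x) (fun x => - u' x)); auto.
- intros x Hx; apply (is_derive_opp u x), Hd, Hx.
- intros x Hx; specialize (Hp x Hx); lra.
Qed.

Lemma is_derive_cst (c t : R) : is_derive (fun _ : R => c) t 0.
Proof. exact (@is_derive_const R_AbsRing R_NormedModule c t). Qed.

Lemma is_derive_primitive (g : R -> R) (t : R) :
  (forall s, continuous g s) -> is_derive (fun b => RInt g 0 b) t (g t).
Proof.
intros Hg; apply (is_derive_RInt g _ 0).
- apply filter_forall; intros b; apply (@RInt_correct R_CompleteNormedModule).
  apply (@ex_RInt_continuous R_CompleteNormedModule); auto.
- apply Hg.
Qed.

(** The integrating factor of [u' + P u]. *)
Definition weight (P : R -> R) (t : R) : R := exp (RInt P 0 t).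

Lemma weight_pos P t : 0 < weight P t.
Proof. apply exp_pos. Qed.

Lemma is_derive_weight (P : R -> R) (t : R) :
  (forall s, continuous P s) -> is_derive (weight P) t (P t * weight P t).
Proof.
intros HP; unfold weight.
apply (is_derive_comp exp (fun s => RInt P 0 s)).
- apply is_derive_exp.
- apply is_derive_primitive, HP.
Qed.

(** [limsup u <= 0] at minus infinity. *)
Definition nonpos_at_m_infty (u : R -> R) : Prop :=
  forall eps, 0 < eps -> exists M, forall t, t <= M -> u t <= eps.

Lemma weight_le_1 (P : R -> R) (t : R) :
  (forall s, continuous P s) -> (forall s, 0 <= P s) -> t <= 0 ->
  weight P t <= 1.
Proof.
intros HP HP0 Ht.
replace 1 with (weight P 0).
- apply (nondecreasing_of_derive (weight P) (fun s => P s * weight P s)); auto.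
  + intros x _; apply is_derive_weight, HP.
  + intros x _; apply Rmult_le_pos; [apply HP0 | apply Rlt_le, weight_pos].
- unfold weight; rewrite RInt_point; apply exp_0.
Qed.

(** The product of [u] with the integrating factor of [P] is nonincreasing; as
    [P] is nonnegative, that factor is at most [1] on the negative half-line, so
    the product has a nonpositive upper limit at minus infinity. *)
Lemma comparison (P u u' : R -> R) :
  (forall t, continuous P t) -> (forall t, 0 <= P t) ->
  (forall t, is_derive u t (u' t)) -> (forall t, u' t <= - P t * u t) ->
  nonpos_at_m_infty u -> forall t, u t <= 0.
Proof.
intros HP HP0 Hu Hle Hlim t.
assert (Hw := weight_pos P t).
enough (weight P t * u t <= 0) by nra.
apply le_epsilon; intros eps Heps.
destruct (Hlim eps Heps) as [M HM].
set (s := Rmin M (Rmin t 0)).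
assert (Hs : s <= M /\ s <= t /\ s <= 0).
{ unfold s; generalize (Rmin_l M (Rmin t 0)) (Rmin_r M (Rmin t 0))
    (Rmin_l t 0) (Rmin_r t 0); lra. }
apply Rle_trans with (weight P s * u s).
- apply (nonincreasing_of_derive (fun x => weight P x * u x)
    (fun x => P x * weight P x * u x + weight P x * u' x)); [lra | |].
  + intros x _; apply (is_derive_mult (weight P) u); auto.
    * apply is_derive_weight, HP.
    * intros; apply Rmult_comm.
  + intros x _; generalize (Hle x) (weight_pos P x); nra.
- generalize (HM s ltac:(lra)) (weight_le_1 P s HP HP0 ltac:(lra))
    (weight_pos P s); nra.
Qed.

Lemma is_derive_exp_linear (mu t : R) :
  is_derive (fun s => exp (mu * s)) t (mu * exp (mu * t)).
Proof. auto_derive; auto; ring. Qed.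

Lemma exp_linear_small (K mu eps : R) :
  0 < mu -> 0 < eps -> exists M, forall t, t <= M -> K * exp (mu * t) <= eps.
Proof.
intros Hmu Heps.
exists (ln (eps / (Rabs K + 1)) / mu); intros t Ht.
assert (HK := Rabs_pos K). assert (HK' := Rle_abs K).
assert (Hq : 0 < eps / (Rabs K + 1)) by (apply Rdiv_lt_0_compat; lra).
assert (E : exp (mu * t) <= eps / (Rabs K + 1)).
{ rewrite <- (exp_ln _ Hq).
  apply (Rmult_le_compat_l mu) in Ht; [|lra].
  replace (mu * (ln (eps / (Rabs K + 1)) / mu))
    with (ln (eps / (Rabs K + 1))) in Ht by (field; lra).
  destruct Ht as [Ht | ->]; [left; now apply exp_increasing | right; auto]. }
apply Rle_trans with ((Rabs K + 1) * (eps / (Rabs K + 1))).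
- generalize (exp_pos (mu * t)); nra.
- right; field; lra.
Qed.

Lemma nonpos_of_exp_bound (u : R -> R) (K mu : R) :
  0 < mu -> (forall t, u t <= K * exp (mu * t)) -> nonpos_at_m_infty u.
Proof.
intros Hmu Hu eps Heps.
destruct (exp_linear_small K mu eps Hmu Heps) as [M HM].
exists M; intros t Ht; specialize (HM t Ht); specialize (Hu t); lra.
Qed.

(** The function [C / (mu + p) * exp (mu t)] is a supersolution of
    [y' + P y = +- C exp (mu t)], hence a barrier for [y] and for [- y].  A bound
    by any growing exponential, however bad its constant and rate, is therefore
    improved to the sharp one; applied to differences of solutions, this is where
    the contraction factor comes from. *)
Lemma decay_estimate (P y y' : R -> R) (p mu C K nu : R) :
  (forall t, continuous P t) -> (forall t, p <= P t) -> 0 <= p -> 0 < mu ->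
  (forall t, is_derive y t (y' t)) ->
  (forall t, Rabs (y' t + P t * y t) <= C * exp (mu * t)) ->
  0 < nu -> (forall t, Rabs (y t) <= K * exp (nu * t)) ->
  forall t, Rabs (y t) <= C / (mu + p) * exp (mu * t).
Proof.
intros HP Hp Hp0 Hmu Hy Hle Hnu Hvan t.
set (k := C / (mu + p)).
assert (Hk : k * (mu + p) = C) by (unfold k; field; lra).
assert (HC : 0 <= C).
{ generalize (Rabs_pos (y' 0 + P 0 * y 0)) (Hle 0) (exp_pos (mu * 0)); nra. }
assert (Hk0 : 0 <= k) by (unfold k; apply Rcomplements.Rdiv_le_0_compat; lra).
assert (One : forall e, (e = 1 \/ e = -1) -> forall s, e * y s - k * exp (mu * s) <= 0).
{ intros e He.
  apply (comparison P _ (fun s => e * y' s - k * (mu * exp (mu * s)))); auto.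
  - intros s; generalize (Hp s); lra.
  - intros s. apply (is_derive_minus (fun s => e * y s) (fun s => k * exp (mu * s))).
    + apply (is_derive_scal y s e); auto.
    + apply (is_derive_scal (fun s => exp (mu * s)) s k), is_derive_exp_linear.
  - intros s.
    assert (Hs := Hle s); apply Rabs_le_between in Hs.
    assert (k * (P s - p) * exp (mu * s) >= 0).
    { apply Rle_ge, Rmult_le_pos; [apply Rmult_le_pos; [lra|]|].
      generalize (Hp s); lra. apply Rlt_le, exp_pos. }
    rewrite <- Hk in Hs.
    destruct He as [-> | ->]; lra.
  - apply (nonpos_of_exp_bound _ K nu Hnu); intros s.
    generalize (Hvan s) (Rle_abs (y s)) (Rle_abs (- y s)) (exp_pos (mu * s)).
    rewrite Rabs_Ropp; intros ? ? ? ?.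
    assert (0 <= k * exp (mu * s)) by (apply Rmult_le_pos; lra).
    destruct He as [-> | ->]; lra. }
apply Rabs_le_between; generalize (One 1 (or_introl eq_refl) t)
  (One (-1) (or_intror eq_refl) t); lra.
Qed.

(** Variation of constants from minus infinity.  Write [y = (Phi - L) / W] with
    [W] the integrating factor, [Phi] a primitive of [g W] and [L] the limit of
    [Phi] at minus infinity.  With [B = C / (mu + p) * exp (mu t) * W], the
    function [Phi + B] is nondecreasing and [Phi - B] nonincreasing, so the
    supremum of [Phi - B] is a number within [B t] of [Phi t] for every [t]: it
    serves as [L] and gives the estimate on [y] without any improper integral. *)
Lemma decaying_solution (P g : R -> R) (p mu C : R) :
  (forall t, continuous P t) -> (forall t, p <= P t) -> 0 <= p -> 0 < mu ->
  (forall t, continuous g t) -> (forall t, Rabs (g t) <= C * exp (mu * t)) ->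
  exists y, (forall t, is_derive y t (g t - P t * y t)) /\
    forall t, Rabs (y t) <= C / (mu + p) * exp (mu * t).
Proof.
intros HP Hp Hp0 Hmu Hg Hle.
set (k := C / (mu + p)).
assert (Hk : k * (mu + p) = C) by (unfold k; field; lra).
assert (HC : 0 <= C).
{ generalize (Rabs_pos (g 0)) (Hle 0) (exp_pos (mu * 0)); nra. }
assert (Hk0 : 0 <= k) by (unfold k; apply Rcomplements.Rdiv_le_0_compat; lra).
set (W := weight P).
assert (HW : forall t, 0 < W t) by (intros; apply weight_pos).
assert (HW' : forall t, is_derive W t (P t * W t)) by (intros; apply is_derive_weight, HP).
set (Phi := fun t => RInt (fun s => g s * W s) 0 t).
assert (HPhi : forall t, is_derive Phi t (g t * W t)).
{ intros t; apply (is_derive_primitive (fun s => g s * W s)); intros s.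
  apply (continuous_mult (K := R_AbsRing)); auto.
  apply (continuous_of_derive W s _ (HW' s)). }
set (B := fun t => k * (exp (mu * t) * W t)).
assert (HB0 : forall t, 0 <= B t).
{ intros t; unfold B; apply Rmult_le_pos; auto; apply Rmult_le_pos.
  apply Rlt_le, exp_pos. apply Rlt_le, HW. }
set (B' := fun t => k * (mu * exp (mu * t) * W t + exp (mu * t) * (P t * W t))).
assert (HB : forall t, is_derive B t (B' t)).
{ intros t; unfold B, B'.
  apply (is_derive_scal (fun s => exp (mu * s) * W s)).
  apply (is_derive_mult (fun s => exp (mu * s)) W); auto.
  apply is_derive_exp_linear. intros; apply Rmult_comm. }
assert (HBg : forall t, Rabs (g t * W t) <= B' t).
{ intros t; rewrite Rabs_mult, (Rabs_pos_eq (W t)) by apply Rlt_le, HW.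
  apply Rle_trans with (C * exp (mu * t) * W t).
  - apply Rmult_le_compat_r; auto. apply Rlt_le, HW.
  - unfold B'; rewrite <- Hk.
    assert (0 <= k * (P t - p) * (exp (mu * t) * W t)).
    { apply Rmult_le_pos; [apply Rmult_le_pos; [lra|]|].
      generalize (Hp t); lra. apply Rmult_le_pos; apply Rlt_le; [apply exp_pos|apply HW]. }
    lra. }
assert (Up : forall s t, s <= t -> Phi s + B s <= Phi t + B t).
{ intros s t Hst.
  apply (nondecreasing_of_derive (fun x => Phi x + B x) (fun x => g x * W x + B' x)); auto.
  - intros x _; apply (is_derive_plus Phi B); auto.
  - intros x _; generalize (HBg x); intros H; apply Rabs_le_between in H; lra. }
assert (Dn : forall s t, s <= t -> Phi t - B t <= Phi s - B s).
{ intros s t Hst.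
  apply (nonincreasing_of_derive (fun x => Phi x - B x) (fun x => g x * W x - B' x)); auto.
  - intros x _; apply (is_derive_minus Phi B); auto.
  - intros x _; generalize (HBg x); intros H; apply Rabs_le_between in H; lra. }
assert (Cross : forall s t, Phi s - B s <= Phi t + B t).
{ intros s t; destruct (Rle_dec s t) as [H | H].
  - generalize (Up s t H) (HB0 s); lra.
  - generalize (Dn t s ltac:(lra)) (HB0 t); lra. }
destruct (completeness (fun v => exists s, v = Phi s - B s)) as [L [HL1 HL2]].
{ exists (Phi 0 + B 0); intros v [s ->]; auto. }
{ now exists (Phi 0 - B 0), 0. }
exists (fun t => (Phi t - L) / W t); split; intros t.
- assert (Hwt := HW t).
  evar_last.
  + apply (is_derive_div (fun t => Phi t - L) W); auto; [|lra].
    apply (is_derive_minus Phi (fun _ => L)); auto. apply is_derive_const.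
  + unfold minus, plus, opp, zero; simpl; field; lra.
- assert (Hwt := HW t).
  rewrite Rabs_div, (Rabs_pos_eq (W t)) by lra.
  apply Rcomplements.Rle_div_l; [lra|].
  replace (k * exp (mu * t) * W t) with (B t) by (unfold B; ring).
  apply Rabs_le_between.
  assert (Phi t - B t <= L) by (apply HL1; now exists t).
  assert (L <= Phi t + B t) by (apply HL2; intros v [s ->]; auto).
  lra.
Qed.

(** * Contraction in a weighted supremum distance *)

Lemma half_pow_small (K eps : R) : 0 < eps -> exists N, forall n, (N <= n)%nat ->
  K * (/ 2) ^ n <= eps.
Proof.
intros Heps.
assert (HK := Rabs_pos K). assert (HK' := Rle_abs K).
assert (Hq : 0 < eps / (Rabs K + 1)) by (apply Rdiv_lt_0_compat; lra).
destruct (pow_lt_1_zero (/ 2) ltac:(rewrite Rabs_pos_eq; lra) _ Hq) as [N HN].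
exists N; intros n Hn; specialize (HN n Hn).
assert (Hp : 0 < (/ 2) ^ n) by (apply pow_lt; lra).
rewrite Rabs_pos_eq in HN by lra.
apply Rle_trans with ((Rabs K + 1) * (eps / (Rabs K + 1))).
- nra.
- right; field; lra.
Qed.

Lemma geometric_limit (x : nat -> R) (K : R) :
  (forall n, Rabs (x (S n) - x n) <= K * (/ 2) ^ n) ->
  exists l, forall n, Rabs (x n - l) <= 2 * K * (/ 2) ^ n.
Proof.
intros H.
assert (Hpow : forall n, 0 < (/ 2) ^ n) by (intros; apply pow_lt; lra).
assert (Hmn : forall m n, Rabs (x (n + m)%nat - x n) <= 2 * K * (/ 2) ^ n - 2 * K * (/ 2) ^ (n + m)).
{ induction m as [|m IH]; intros n.
  - rewrite Nat.add_0_r; rewrite Rminus_diag_eq, Rabs_R0 by auto; lra.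
  - rewrite Nat.add_succ_r.
    replace (x (S (n + m)) - x n)
      with ((x (S (n + m)) - x (n + m)%nat) + (x (n + m)%nat - x n)) by ring.
    eapply Rle_trans; [apply Rabs_triang|].
    generalize (H (n + m)%nat) (IH n); simpl; lra. }
assert (HK : 0 <= K).
{ generalize (Rabs_pos (x 1%nat - x 0%nat)) (H 0%nat); simpl; lra. }
assert (Hmn' : forall m n, (n <= m)%nat -> Rabs (x m - x n) <= 2 * K * (/ 2) ^ n).
{ intros m n Hle; replace m with (n + (m - n))%nat by (rewrite Nat.add_comm; now apply Nat.sub_add).
  eapply Rle_trans; [apply Hmn|].
  generalize (Hpow (n + (m - n))%nat); nra. }
assert (HC : ex_finite_lim_seq x).
{ apply ex_lim_seq_cauchy_corr; intros eps.
  destruct (half_pow_small (4 * K) (eps / 2)) as [N HN].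
  { generalize (cond_pos eps); lra. }
  exists N; intros n m Hn Hm.
  replace (x n - x m) with ((x n - x N) - (x m - x N)) by ring.
  eapply Rle_lt_trans; [apply Rabs_triang|]; rewrite Rabs_Ropp.
  generalize (Hmn' n N Hn) (Hmn' m N Hm) (HN N (Nat.le_refl N)) (cond_pos eps); lra. }
destruct HC as [l Hl]; exists l; intros n.
rewrite Rabs_minus_sym.
apply (is_lim_seq_le_loc (fun m => Rabs (x m - x n)) (fun _ => 2 * K * (/ 2) ^ n)
  (Rabs (l - x n)) (2 * K * (/ 2) ^ n)).
- exists n; intros m Hm; auto.
- apply (is_lim_seq_abs _ (l - x n)).
  apply is_lim_seq_minus'; auto. apply is_lim_seq_const.
- apply is_lim_seq_const.
Qed.

(** The contraction principle in the distance [sup |a - b| / w], for a map given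
    by its graph [S].  Only a half is asked of the contraction constant, and
    [Y] must be complete in the form of its last hypothesis. *)
Lemma weighted_fixed_point (Y : (R -> R) -> Prop) (S : (R -> R) -> (R -> R) -> Prop)
    (w : R -> R) (C0 : R) :
  (exists a, Y a) ->
  (forall a, Y a -> exists a1, Y a1 /\ S a a1) ->
  (forall a b a1 b1 C, Y a -> Y b -> Y a1 -> Y b1 -> S a a1 -> S b b1 ->
     (forall t, Rabs (a t - b t) <= C * w t) ->
     forall t, Rabs (a1 t - b1 t) <= C / 2 * w t) ->
  (forall a b, Y a -> Y b -> forall t, Rabs (a t - b t) <= C0 * w t) ->
  (forall (x : nat -> R -> R) a K, (forall n, Y (x n)) ->
     (forall n t, Rabs (x n t - a t) <= K * (/ 2) ^ n * w t) -> Y a) ->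
  exists a, Y a /\ S a a.
Proof.
intros [a0 Ha0] Hex Hcon Hdiam Hclosed.
set (T := fun a : {a | Y a} =>
  let (a1, H) := constructive_indefinite_description _ (Hex (proj1_sig a) (proj2_sig a)) in
  exist Y a1 (proj1 H)).
assert (HT : forall a, S (proj1_sig a) (proj1_sig (T a))).
{ intros a; unfold T.
  now destruct constructive_indefinite_description as [a1 [H1 H2]]. }
set (x := nat_rect (fun _ => {a | Y a}) (exist Y a0 Ha0) (fun _ => T)).
assert (Hstep : forall n t,
  Rabs (proj1_sig (x (Datatypes.S n)) t - proj1_sig (x n) t) <= C0 * w t * (/ 2) ^ n).
{ assert (E : forall n t,
    Rabs (proj1_sig (x (Datatypes.S n)) t - proj1_sig (x n) t) <= C0 * (/ 2) ^ n * w t).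
  { induction n as [|n IH]; intros t.
    - simpl pow; rewrite Rmult_1_r; apply Hdiam; apply proj2_sig.
    - replace (C0 * (/ 2) ^ Datatypes.S n * w t) with (C0 * (/ 2) ^ n / 2 * w t)
        by (simpl; field).
      apply (Hcon (proj1_sig (x (Datatypes.S n))) (proj1_sig (x n)));
        try apply proj2_sig; auto; apply HT. }
  intros n t; rewrite Rmult_assoc, (Rmult_comm (w t)), <- Rmult_assoc; auto. }
destruct (functional_choice
  (fun t l => forall n, Rabs (proj1_sig (x n) t - l) <= 2 * (C0 * w t) * (/ 2) ^ n)) as [a Ha].
{ intros t; apply (geometric_limit (fun n => proj1_sig (x n) t)); intros n; apply Hstep. }
assert (Ha' : forall n t, Rabs (proj1_sig (x n) t - a t) <= 2 * C0 * (/ 2) ^ n * w t).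
{ intros n t; eapply Rle_trans; [apply Ha | right; ring]. }
assert (HY : Y a).
{ apply (Hclosed (fun n => proj1_sig (x n)) a (2 * C0)); auto; intros; apply proj2_sig. }
exists a; split; auto.
destruct (Hex a HY) as [a1 [HY1 HS1]].
(* Both [a] and its image [a1] are limits of the sequence of iterates. *)
replace a1 with a in HS1; auto.
apply functional_extensionality; intros t.
apply cond_eq; intros eps Heps.
destruct (half_pow_small (2 * C0 * w t) (eps / 2) ltac:(lra)) as [N HN].
specialize (HN N (Nat.le_refl N)).
assert (H1 : Rabs (proj1_sig (x (Datatypes.S N)) t - a1 t) <= 2 * C0 * (/ 2) ^ N / 2 * w t).
{ apply (Hcon (proj1_sig (x N)) a); try apply proj2_sig; auto; apply HT. }
assert (H2 := Ha' (Datatypes.S N) t).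
simpl pow in H2.
replace (a t - a1 t) with (- (proj1_sig (x (Datatypes.S N)) t - a t)
  + (proj1_sig (x (Datatypes.S N)) t - a1 t)) by ring.
eapply Rle_lt_trans; [apply Rabs_triang|]; rewrite Rabs_Ropp.
lra.
Qed.

(** * The unstable manifold of the cusp as a fixed point *)

(** The unstable eigenvalue of the hyperbolic cusp: the linearization of
    [a' = q / 2 - (1 + q) a], [q' = 2 a - 2 a ^ 2] at [0] has characteristic
    polynomial [X ^ 2 + X - 1]. *)
Definition lambda : R := (sqrt 5 - 1) / 2.

Lemma lambda_eq : lambda * lambda + lambda = 1.
Proof. unfold lambda; generalize (sqrt_sqrt 5 ltac:(lra)); lra. Qed.

Lemma lambda_bounds : 3 / 5 < lambda < 2 / 3.
Proof.
assert (0 <= sqrt 5) by apply sqrt_pos.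
assert (E := sqrt_sqrt 5 ltac:(lra)).
unfold lambda; split; nra.
Qed.

(** The unstable solution of the linearized system is
    [(mode, 2 / lambda * mode)]. *)
Definition mode (t : R) : R := exp (lambda * t).

Lemma mode_pos t : 0 < mode t.
Proof. apply exp_pos. Qed.

Lemma mode_square t : mode t * mode t = exp (2 * lambda * t).
Proof. unfold mode; rewrite <- exp_plus; f_equal; ring. Qed.

Lemma is_derive_mode t : is_derive mode t (lambda * mode t).
Proof. apply is_derive_exp_linear. Qed.

(** The bounds [class_upper] and [class_lower] prescribe the leading term of [a]
    at the cusp: two elements differ by [O (mode ^ 2)], a weight in which the
    iteration contracts, and no element vanishes near minus infinity, which
    excludes the stationary solution. *)
Record cusp_class (a : R -> R) : Prop := {
  class_continuous : forall t, continuous a t;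
  class_bounds : forall t, 0 <= a t <= / 2;
  class_upper : forall t, a t <= mode t;
  class_lower : forall t, mode t - 4 * (mode t * mode t) <= a t }.

Definition soliton_q (a q : R -> R) : Prop :=
  (forall t, is_derive q t (2 * a t - 2 * (a t * a t))) /\
  (forall t, 0 <= q t <= 2 / lambda * mode t).

(** One iteration: integrate [q' = 2 a - 2 a ^ 2] from [q = 0] at minus infinity,
    then solve [a1' = q / 2 - (1 + q) a1].  A fixed point is a solution of the
    nonlinear system. *)
Definition soliton_step (a a1 : R -> R) : Prop :=
  exists q, soliton_q a q /\
    forall t, is_derive a1 t (q t / 2 - (1 + q t) * a1 t).

Lemma cusp_class_inhabited : cusp_class (fun t => mode t / (1 + 2 * mode t)).
Proof.
assert (Hz := mode_pos).
assert (Hb : forall t, mode t / (1 + 2 * mode t) * (1 + 2 * mode t) = mode t).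
{ intros t; field; specialize (Hz t); lra. }
split; intros t; specialize (Hz t); specialize (Hb t).
- eapply continuous_of_derive; apply (is_derive_div mode (fun s => 1 + 2 * mode s)).
  + apply is_derive_mode.
  + apply (is_derive_plus (fun _ => 1) (fun s => 2 * mode s)); [apply is_derive_const|].
    apply (is_derive_scal mode t 2), is_derive_mode.
  + lra.
- set (v := mode t / (1 + 2 * mode t)) in *; split; nra.
- set (v := mode t / (1 + 2 * mode t)) in *; nra.
- set (v := mode t / (1 + 2 * mode t)) in *.
  assert (0 <= v) by nra. assert (v <= mode t) by nra. nra.
Qed.

(** Continuity passes to the limit because the weight is bounded on every
    half-line [t <= t0 + 1], where the convergence is thus uniform. *)
Lemma cusp_class_closed (x : nat -> R -> R) (a : R -> R) (K : R) :
  (forall n, cusp_class (x n)) ->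
  (forall n t, Rabs (x n t - a t) <= K * (/ 2) ^ n * (mode t * mode t)) ->
  cusp_class a.
Proof.
intros HY Hlim.
assert (Happ : forall t eps, 0 < eps -> exists n, Rabs (x n t - a t) <= eps).
{ intros t eps Heps.
  destruct (half_pow_small (K * (mode t * mode t)) eps Heps) as [N HN].
  exists N; specialize (HN N (Nat.le_refl N)); specialize (Hlim N t); lra. }
split; intros t.
- apply filterlim_locally; intros eps.
  destruct (half_pow_small (K * (mode (t + 1) * mode (t + 1))) (eps / 4)) as [N HN].
  { generalize (cond_pos eps); lra. }
  specialize (HN N (Nat.le_refl N)).
  assert (HK : 0 <= K * (/ 2) ^ N).
  { generalize (Rabs_pos (x N 0 - a 0)) (Hlim N 0) (mode_pos 0); intros.
    apply Rmult_le_reg_r with (mode 0 * mode 0); nra. }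
  assert (Hc := class_continuous _ (HY N) t).
  apply filterlim_locally with (eps := pos_div_2 eps) in Hc.
  assert (Hloc : locally t (fun s => s < t + 1)).
  { apply open_lt; lra. }
  generalize (filter_and _ _ Hc Hloc); apply filter_imp; intros s [Hs Hst].
  change (Rabs (x N s - x N t) < eps / 2) in Hs.
  change (Rabs (a s - a t) < eps).
  assert (E : forall r, r <= t + 1 -> Rabs (x N r - a r) <= eps / 4).
  { intros r Hr; eapply Rle_trans; [apply Hlim|].
    eapply Rle_trans; [|apply HN].
    replace (K * (mode (t + 1) * mode (t + 1)) * (/ 2) ^ N)
      with (K * (/ 2) ^ N * (mode (t + 1) * mode (t + 1))) by ring.
    apply Rmult_le_compat_l; [exact HK|].
    assert (mode r <= mode (t + 1)).
    { apply (nondecreasing_of_derive mode (fun u => lambda * mode u)); auto.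
      - intros; apply is_derive_mode.
      - intros u _; generalize (mode_pos u) lambda_bounds; nra. }
    generalize (mode_pos r); nra. }
  generalize (E s ltac:(lra)) (E t ltac:(lra)); intros E1 E2.
  replace (a s - a t) with (- (x N s - a s) + (x N s - x N t) + (x N t - a t)) by ring.
  eapply Rle_lt_trans; [apply Rabs_triang|].
  eapply Rle_lt_trans; [apply Rplus_le_compat_r, Rabs_triang|].
  rewrite Rabs_Ropp; lra.
- split; apply le_epsilon; intros eps Heps; destruct (Happ t eps Heps) as [n Hn];
    apply Rabs_le_between in Hn; generalize (class_bounds _ (HY n) t); lra.
- apply le_epsilon; intros eps Heps; destruct (Happ t eps Heps) as [n Hn];
    apply Rabs_le_between in Hn; generalize (class_upper _ (HY n) t); lra.
- apply le_epsilon; intros eps Heps; destruct (Happ t eps Heps) as [n Hn];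
    apply Rabs_le_between in Hn; generalize (class_lower _ (HY n) t); lra.
Qed.

Lemma soliton_q_exists (a : R -> R) :
  cusp_class a -> exists q, soliton_q a q.
Proof.
intros HY.
assert (Hl := lambda_bounds).
destruct (decaying_solution (fun _ => 0) (fun t => 2 * a t - 2 * (a t * a t)) 0 lambda 2)
  as [q [Hq Hq']]; try (intros; lra).
- intros t; apply continuous_const.
- intros t; assert (Hc := class_continuous _ HY t).
  apply (continuous_minus (fun t => 2 * a t) (fun t => 2 * (a t * a t)));
    apply (continuous_mult (K := R_AbsRing)); try apply continuous_const; auto.
  apply (continuous_mult (K := R_AbsRing)); auto.
- intros t; generalize (class_bounds _ HY t) (class_upper _ HY t); unfold mode; intros.
  rewrite Rabs_pos_eq; nra.
- assert (Hd : forall t, is_derive q t (2 * a t - 2 * (a t * a t))).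
  { intros t; evar_last; [apply Hq | ring]. }
  exists q; split; auto; intros t.
  rewrite Rplus_0_r in Hq'.
  split; [|eapply Rle_trans; [apply Rle_abs | apply Hq']].
  enough (- q t <= 0) by lra.
  revert t; apply (comparison (fun _ => 0) _ (fun t => - (2 * a t - 2 * (a t * a t)))).
  + intros; apply continuous_const.
  + intros; lra.
  + intros t; apply (is_derive_opp q); auto.
  + intros t; generalize (class_bounds _ HY t); nra.
  + apply (nonpos_of_exp_bound _ (2 / lambda) lambda); [lra|]; intros t.
    generalize (Hq' t) (Rle_abs (- q t)); rewrite Rabs_Ropp; lra.
Qed.

(** The class is stable because [lambda (lambda + 1) = 1]: the bound
    [a <= mode] gives [q <= 2 / lambda * mode], then
    [a1 <= mode / (lambda (lambda + 1)) = mode].  For the lower bound, the errors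
    [q - 2 / lambda * mode] and [a1 - mode] solve linear equations whose right
    hand sides are quadratic in [mode]. *)
Lemma soliton_step_exists (a : R -> R) :
  cusp_class a -> exists a1, cusp_class a1 /\ soliton_step a a1.
Proof.
intros HY; destruct (soliton_q_exists a HY) as [q [Hq Hb]].
assert (Hl := lambda_bounds). assert (He := lambda_eq).
assert (Hil : / lambda = 1 + lambda).
{ apply Rmult_eq_reg_l with lambda; [|lra]; rewrite Rinv_r by lra; lra. }
assert (Hqc : forall t, continuous q t).
{ intros t; apply (continuous_of_derive _ _ _ (Hq t)). }
assert (HPc : forall t, continuous (fun s => 1 + q s) t).
{ intros t; apply (continuous_plus (fun _ => 1) q); auto. apply continuous_const. }
destruct (decaying_solution (fun t => 1 + q t) (fun t => q t / 2) 1 lambda (/ lambda))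
  as [a1 [Ha Ha']]; auto; try lra.
{ intros t; generalize (Hb t); lra. }
{ intros t; apply (continuous_mult (K := R_AbsRing)); auto; apply continuous_const. }
{ intros t; rewrite Rabs_pos_eq by (generalize (Hb t); lra).
  generalize (Hb t); unfold mode; lra. }
replace (/ lambda / (lambda + 1)) with 1 in Ha' by (rewrite Hil; field; lra).
assert (Hup : forall t, a1 t <= mode t).
{ intros t; generalize (Ha' t) (Rle_abs (a1 t)); unfold mode; lra. }
assert (Hlo : forall t, - a1 t <= mode t).
{ intros t; generalize (Ha' t) (Rle_abs (- a1 t)); rewrite Rabs_Ropp; unfold mode; lra. }
exists a1; split; [|now exists q; split; [split|]].
assert (Hqz : forall t, Rabs (q t - 2 / lambda * mode t) <= 10 / (2 * lambda + 0) * exp (2 * lambda * t)).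
{ apply (decay_estimate (fun _ => 0) _
    (fun t => 2 * a t - 2 * (a t * a t) - 2 / lambda * (lambda * mode t)) 0
    (2 * lambda) 10 (2 / lambda) lambda); try (intros; lra).
  - intros; apply continuous_const.
  - intros t; apply (is_derive_minus q (fun t => 2 / lambda * mode t)); auto.
    apply (is_derive_scal mode), is_derive_mode.
  - intros t; rewrite <- mode_square.
    replace (2 / lambda * (lambda * mode t)) with (2 * mode t) by (field; lra).
    generalize (class_bounds _ HY t) (class_upper _ HY t) (class_lower _ HY t).
    intros; apply Rabs_le_between; nra.
  - intros t; generalize (Hb t); unfold mode; intros; apply Rabs_le_between; lra. }
(* The linear terms cancel by [1 / lambda = 1 + lambda]; what remains is at most
   [5 / (2 lambda) mode ^ 2] from [q / 2] and [2 / lambda * mode ^ 2] from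
   [q mode]. *)
assert (Haz : forall t, Rabs (a1 t - mode t) <=
  (9 / 2 / lambda) / (2 * lambda + 1) * exp (2 * lambda * t)).
{ apply (decay_estimate (fun t => 1 + q t) _
    (fun t => q t / 2 - (1 + q t) * a1 t - lambda * mode t) 1
    (2 * lambda) (9 / 2 / lambda) 2 lambda); auto; try lra.
  - intros t; generalize (Hb t); lra.
  - intros t; apply (is_derive_minus a1 mode); auto. apply is_derive_mode.
  - intros t; rewrite <- mode_square.
    assert (H := Hqz t); rewrite <- mode_square in H.
    replace (10 / (2 * lambda + 0)) with (5 * / lambda) in H by (field; lra).
    unfold Rdiv in *; rewrite Hil in *.
    replace (q t * / 2 - (1 + q t) * a1 t - lambda * mode t + (1 + q t) * (a1 t - mode t))
      with ((q t - 2 * (1 + lambda) * mode t) / 2 - q t * mode t) by field.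
    apply Rabs_le_between in H; apply Rabs_le_between.
    generalize (Hb t) (mode_pos t); intros. nra.
  - intros t; apply Rabs_le_between; generalize (Hup t) (Hlo t) (mode_pos t); unfold mode; lra. }
split; auto; intros t.
- apply (continuous_of_derive _ _ _ (Ha t)).
- split; [enough (- a1 t <= 0) by lra | enough (a1 t - / 2 <= 0) by lra]; revert t.
  + apply (comparison (fun t => 1 + q t) _ (fun t => - (q t / 2 - (1 + q t) * a1 t))); auto.
    * intros t; generalize (Hb t); lra.
    * intros t; apply (is_derive_opp a1); auto.
    * intros t; generalize (Hb t); lra.
    * apply (nonpos_of_exp_bound _ 1 lambda); [lra|].
      intros t; generalize (Hlo t); unfold mode; lra.
  + apply (comparison (fun t => 1 + q t) _ (fun t => (q t / 2 - (1 + q t) * a1 t) - 0)); auto.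
    * intros t; generalize (Hb t); lra.
    * intros t; apply (is_derive_minus a1 (fun _ => / 2)); auto.
      apply is_derive_cst.
    * intros t; generalize (Hb t); lra.
    * apply (nonpos_of_exp_bound _ 1 lambda); [lra|].
      intros t; generalize (Hup t); unfold mode; lra.
- specialize (Haz t); rewrite <- mode_square in Haz.
  assert (Hk : 9 / 2 / lambda / (2 * lambda + 1) <= 4).
  { unfold Rdiv; rewrite Hil.
    apply Rcomplements.Rle_div_l; [lra|]. lra. }
  apply Rabs_le_between in Haz; generalize (mode_pos t); nra.
Qed.

(** With the weight [exp (mu t)], the two integrations divide the error by
    [mu] and by [mu + 1]; their product exceeds [2] for [mu = 2 lambda], while it
    is only [1] for [mu = lambda].  The nonlinear terms do no harm since
    [0 <= 1 - a - b <= 1] and [0 <= / 2 - b1 <= / 2]. *)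
Lemma soliton_step_contracts (a b a1 b1 : R -> R) (C : R) :
  cusp_class a -> cusp_class b -> cusp_class a1 -> cusp_class b1 ->
  soliton_step a a1 -> soliton_step b b1 ->
  (forall t, Rabs (a t - b t) <= C * (mode t * mode t)) ->
  forall t, Rabs (a1 t - b1 t) <= C / 2 * (mode t * mode t).
Proof.
intros Ya Yb Ya1 Yb1 [q [[Hq Hqb] Ha1]] [p [[Hp Hpb] Hb1]] Hab.
assert (Hl := lambda_bounds). assert (He := lambda_eq).
assert (HC : 0 <= C).
{ generalize (Rabs_pos (a 0 - b 0)) (Hab 0) (mode_pos 0); intros.
  apply Rmult_le_reg_r with (mode 0 * mode 0); nra. }
assert (Hqp : forall t, Rabs (q t - p t) <= 2 * C / (2 * lambda + 0) * exp (2 * lambda * t)).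
{ apply (decay_estimate (fun _ => 0) _
    (fun t => 2 * a t - 2 * (a t * a t) - (2 * b t - 2 * (b t * b t))) 0
    (2 * lambda) (2 * C) (2 / lambda) lambda); try (intros; lra).
  - intros; apply continuous_const.
  - intros t; apply (is_derive_minus q p); auto.
  - intros t; rewrite <- mode_square.
    assert (H := Hab t); apply Rabs_le_between in H.
    generalize (class_bounds _ Ya t) (class_bounds _ Yb t); intros.
    apply Rabs_le_between.
    replace (2 * a t - 2 * (a t * a t) - (2 * b t - 2 * (b t * b t)) + 0 * (q t - p t))
      with (2 * (a t - b t) * (1 - a t - b t)) by ring.
    assert (0 <= C * (mode t * mode t)) by (apply Rmult_le_pos; auto; generalize (mode_pos t); nra).
    split; nra.
  - intros t; generalize (Hqb t) (Hpb t); unfold mode; intros; apply Rabs_le_between; lra. }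
intros t.
apply Rle_trans with (C / (2 * lambda) / (2 * lambda + 1) * exp (2 * lambda * t)).
- revert t; apply (decay_estimate (fun t => 1 + q t) _
    (fun t => q t / 2 - (1 + q t) * a1 t - (p t / 2 - (1 + p t) * b1 t)) 1
    (2 * lambda) (C / (2 * lambda)) 1 lambda); try lra.
  + intros t; apply (continuous_plus (fun _ => 1) q); [apply continuous_const|].
    apply (continuous_of_derive _ _ _ (Hq t)).
  + intros t; generalize (Hqb t); lra.
  + intros t; apply (is_derive_minus a1 b1); auto.
  + intros t.
    replace (q t / 2 - (1 + q t) * a1 t - (p t / 2 - (1 + p t) * b1 t) + (1 + q t) * (a1 t - b1 t))
      with ((q t - p t) * (/ 2 - b1 t)) by field.
    rewrite Rabs_mult.
    assert (E := Hqp t). replace (2 * C / (2 * lambda + 0)) with (2 * (C / (2 * lambda))) in E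
      by (field; lra).
    generalize (class_bounds _ Yb1 t); intros.
    rewrite (Rabs_pos_eq (/ 2 - b1 t)) by lra.
    generalize (Rabs_pos (q t - p t)); nra.
  + intros t; generalize (class_bounds _ Ya1 t) (class_bounds _ Yb1 t)
      (class_upper _ Ya1 t) (class_upper _ Yb1 t); unfold mode; intros; apply Rabs_le_between; lra.
- rewrite <- mode_square; apply Rmult_le_compat_r; [generalize (mode_pos t); nra|].
  apply Rcomplements.Rle_div_l; [lra|]. apply Rcomplements.Rle_div_l; [lra|]. nra.
Qed.

Theorem soliton_trajectory : exists a, cusp_class a /\ soliton_step a a.
Proof.
apply (weighted_fixed_point _ _ (fun t => mode t * mode t) 4).
- eexists; apply cusp_class_inhabited.
- apply soliton_step_exists.
- apply soliton_step_contracts.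
- intros a b Ya Yb t; apply Rabs_le_between.
  generalize (class_upper _ Ya t) (class_upper _ Yb t)
    (class_lower _ Ya t) (class_lower _ Yb t); lra.
- apply cusp_class_closed.
Qed.

(** * The trajectory leaving the cusp *)

Lemma derive_zero_at_min (u : R -> R) (t l : R) :
  (forall s, 0 <= u s) -> is_derive u t l -> u t = 0 -> l = 0.
Proof.
intros Hu Hd H0.
assert (Hr := proj1 (is_derive_Reals u t l) Hd).
rewrite <- (derive_pt_eq_0 u t l (exist _ l Hr) Hr).
apply deriv_minimum with (t - 1) (t + 1); try lra.
intros x _ _; rewrite H0; apply Hu.
Qed.

(** With [H = h'] and [P = 2 h' - f'], the soliton equations
    [f'' - 2 (h'' + h' ^ 2) + 1/2 = 0] and [h' f' - (h'' + 2 h' ^ 2) + 1/2 = 0]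
    are equivalent to [trajectory_H] and [trajectory_P].  The cusp is the fixed
    point [(/ 2, 1)]. *)
Record cusp_trajectory (H P : R -> R) : Prop := {
  trajectory_H : forall t, is_derive H t (/ 2 - H t * P t);
  trajectory_P : forall t, is_derive P t (/ 2 - 2 * (H t * H t));
  trajectory_H_bounds : forall t, 0 <= H t <= / 2;
  trajectory_H_decay : forall t, / 2 - H t <= mode t;
  trajectory_P_decay : forall t, 0 <= P t - 1 <= 2 / lambda * mode t;
  trajectory_nontrivial : forall t, mode t - 4 * (mode t * mode t) <= / 2 - H t }.

Theorem cusp_trajectory_exists : exists H P, cusp_trajectory H P.
Proof.
destruct soliton_trajectory as [a [Ya [q [[Hq Hqb] Ha]]]].
exists (fun t => / 2 - a t), (fun t => 1 + q t); split; intros t.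
- evar_last.
  + apply (is_derive_minus (fun _ => / 2) a); auto.
    apply is_derive_cst.
  + unfold minus, plus, opp, zero; simpl; field.
- evar_last.
  + apply (is_derive_plus (fun _ => 1) q); auto.
    apply is_derive_cst.
  + unfold minus, plus, opp, zero; simpl; field.
- generalize (class_bounds _ Ya t); lra.
- generalize (class_upper _ Ya t); lra.
- generalize (Hqb t); lra.
- generalize (class_lower _ Ya t); lra.
Qed.

(** A trajectory differs from the stationary solution arbitrarily far in the cusp. *)
Lemma H_lt_half_near_cusp H P : cusp_trajectory H P ->
  forall t, exists s, s <= t /\ H s < / 2.
Proof.
intros T t.
(* [mode - 4 mode ^ 2] is positive as soon as [mode < 1 / 4]. *)
destruct (exp_linear_small 1 lambda (/ 5)) as [M HM];
  [generalize lambda_bounds; lra | lra |].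
exists (Rmin t M); split; [apply Rmin_l|].
specialize (HM (Rmin t M) (Rmin_r t M)).
assert (Hn := trajectory_nontrivial _ _ T (Rmin t M)).
assert (Hz := mode_pos (Rmin t M)).
fold (mode (Rmin t M)) in HM; nra.
Qed.

Lemma P_nondecreasing H P : cusp_trajectory H P ->
  forall s t, s <= t -> P s <= P t.
Proof.
intros T s t Hst; apply (nondecreasing_of_derive P (fun t => / 2 - 2 * (H t * H t))); auto.
- intros x _; apply (trajectory_P _ _ T).
- intros x _; generalize (trajectory_H_bounds _ _ T x); nra.
Qed.

Lemma P_gt_1 H P : cusp_trajectory H P -> forall t, 1 < P t.
Proof.
intros T t; destruct (H_lt_half_near_cusp H P T t) as [s [Hst Hs]].
apply Rlt_le_trans with (P s); [|now apply (P_nondecreasing H P T)].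
assert (H0 := trajectory_H_bounds _ _ T s).
destruct (Rle_lt_or_eq_dec 0 (P s - 1)) as [Hp | Hp];
  [apply (trajectory_P_decay _ _ T) | lra |].
exfalso; enough (/ 2 - 2 * (H s * H s) - 0 = 0) by nra.
apply (derive_zero_at_min (fun t => P t - 1) s); auto.
- intros x; apply (trajectory_P_decay _ _ T).
- apply (is_derive_minus P (fun _ => 1)); [apply (trajectory_P _ _ T)|].
  apply is_derive_cst.
Qed.

Lemma H_strict_bounds H P : cusp_trajectory H P -> forall t, 0 < H t < / 2.
Proof.
intros T t.
assert (H0 := trajectory_H_bounds _ _ T).
assert (Hd := trajectory_H _ _ T t).
split.
- destruct (proj1 (H0 t)) as [|E]; auto; exfalso.
  enough (/ 2 - H t * P t = 0) by (rewrite <- E in *; lra).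
  apply (derive_zero_at_min H t); auto. intros; apply H0.
- destruct (proj2 (H0 t)) as [|E]; auto; exfalso.
  enough (0 - (/ 2 - H t * P t) = 0).
  { generalize (P_gt_1 H P T t); rewrite E in *; lra. }
  apply (derive_zero_at_min (fun t => / 2 - H t) t); auto.
  + intros x; generalize (H0 x); lra.
  + apply (is_derive_minus (fun _ => / 2) H); auto.
    apply is_derive_cst.
  + rewrite E; lra.
Qed.

(** Since [h'' + h' ^ 2 = / 2 - H P + H ^ 2], the planes containing the radial
    direction have sectional curvature [Q - / 2]. *)
Definition Q (H P : R -> R) (t : R) : R := H t * (P t - H t).

Lemma is_derive_Q H P t : cusp_trajectory H P ->
  is_derive (Q H P) t ((P t - H t) * (/ 2 - Q H P t) - H t ^ 3).
Proof.
intros T; unfold Q.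
assert (H1 := trajectory_H _ _ T t). assert (H2 := trajectory_P _ _ T t).
evar_last.
- apply (is_derive_mult H (fun t => P t - H t)).
  + apply H1.
  + apply (is_derive_minus P H); [apply H2 | apply H1].
  + intros; apply Rmult_comm.
- unfold minus, plus, opp, mult; simpl; ring.
Qed.

Lemma continuous_P_minus_H H P : cusp_trajectory H P ->
  forall t, continuous (fun s => P s - H s) t.
Proof.
intros T t; apply (continuous_minus P H).
- apply (continuous_of_derive _ _ _ (trajectory_P _ _ T t)).
- apply (continuous_of_derive _ _ _ (trajectory_H _ _ T t)).
Qed.

(** [Q] tends to [/ 4] at the cusp and satisfies [Q' = m (/ 2 - Q) - H ^ 3] with
    [m = P - H > / 2].  As [H > 0], the value [/ 2] is an upper barrier; as
    [H < / 2], [m / 4 - H ^ 3 > 0] and the value [/ 4] is a lower barrier. *)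
Lemma Q_bounds H P : cusp_trajectory H P -> forall t, / 4 < Q H P t < / 2.
Proof.
intros T.
assert (HH := H_strict_bounds H P T). assert (HP := P_gt_1 H P T).
assert (Hl := lambda_bounds).
assert (Hc := continuous_P_minus_H H P T).
assert (Hd := fun t => is_derive_Q H P t T).
assert (Hm : forall t, 0 <= P t - H t).
{ intros t; generalize (HH t) (HP t); lra. }
assert (H3 : forall t, 0 < H t ^ 3 < / 8).
{ intros t; specialize (HH t); split; simpl; [|nra].
  rewrite Rmult_1_r; repeat apply Rmult_lt_0_compat; lra. }
assert (Up : forall t, Q H P t - / 2 <= 0).
{ apply (comparison (fun t => P t - H t) _
    (fun t => (P t - H t) * (/ 2 - Q H P t) - H t ^ 3 - 0)); auto.
  - intros t; apply (is_derive_minus (Q H P) (fun _ => / 2)); auto.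
    apply is_derive_cst.
  - intros t; generalize (H3 t); lra.
  - apply (nonpos_of_exp_bound _ (/ lambda) lambda); [lra|]; intros t.
    assert (E := proj2 (trajectory_P_decay _ _ T t)).
    fold (mode t); unfold Q, Rdiv in *; generalize (HH t) (HP t); intros.
    assert (H t * (P t - H t) <= / 2 * (P t - H t)) by (apply Rmult_le_compat_r; auto; lra).
    lra. }
assert (Lo : forall t, / 4 - Q H P t <= 0).
{ apply (comparison (fun t => P t - H t) _
    (fun t => 0 - ((P t - H t) * (/ 2 - Q H P t) - H t ^ 3))); auto.
  - intros t; apply (is_derive_minus (fun _ => / 4) (Q H P)); auto.
    apply is_derive_cst.
  - intros t; generalize (H3 t) (HH t) (HP t); lra.
  - apply (nonpos_of_exp_bound _ 1 lambda); [lra|]; intros t.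
    assert (E := trajectory_H_decay _ _ T t).
    fold (mode t); unfold Q; generalize (HH t) (HP t); intros; nra. }
intros t; split.
- destruct (Rle_lt_or_eq_dec 0 (Q H P t - / 4)) as [Hp | Hp];
    [generalize (Lo t); lra | lra |].
  exfalso; enough ((P t - H t) * (/ 2 - Q H P t) - H t ^ 3 - 0 = 0).
  { replace (Q H P t) with (/ 4) in * by lra.
    generalize (H3 t) (HH t) (HP t); lra. }
  apply (derive_zero_at_min (fun t => Q H P t - / 4) t); auto.
  + intros s; generalize (Lo s); lra.
  + apply (is_derive_minus (Q H P) (fun _ => / 4)); auto.
    apply is_derive_cst.
- destruct (Rle_lt_or_eq_dec 0 (/ 2 - Q H P t)) as [Hp | Hp];
    [generalize (Up t); lra | lra |].
  exfalso; enough (0 - ((P t - H t) * (/ 2 - Q H P t) - H t ^ 3) = 0).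
  { rewrite <- Hp in *; generalize (H3 t); lra. }
  apply (derive_zero_at_min (fun t => / 2 - Q H P t) t); auto.
  + intros s; generalize (Up s); lra.
  + apply (is_derive_minus (fun _ => / 2) (Q H P)); auto.
    apply is_derive_cst.
Qed.

(** Put [a = / 2 - H] and [q0 = P 0 - 1 > 0].  For [t >= 0],
    [a' >= q0 / 2 - (1 + q0) a], so [a] stays above the constant [c] below, and
    then [P' = 2 a (1 - a) >= a >= c]. *)
Lemma P_linear_growth H P : cusp_trajectory H P ->
  exists c, 0 < c /\ forall t, 0 <= t -> 1 + c * t <= P t.
Proof.
intros T.
assert (HH := H_strict_bounds H P T). assert (HP := P_gt_1 H P T).
set (q0 := P 0 - 1).
assert (Hq0 : 0 < q0) by (unfold q0; generalize (HP 0); lra).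
set (c := Rmin (/ 2 - H 0) (q0 / (2 * (1 + q0)))).
assert (Hc : 0 < c).
{ unfold c; apply Rmin_glb_lt; [generalize (HH 0); lra|].
  apply Rdiv_lt_0_compat; lra. }
assert (Hc1 : c <= / 2 - H 0) by apply Rmin_l.
assert (Hc2 : (1 + q0) * c <= q0 / 2).
{ replace (q0 / 2) with ((1 + q0) * (q0 / (2 * (1 + q0)))) by (field; lra).
  apply Rmult_le_compat_l; [lra | apply Rmin_r]. }
assert (Ha : forall t, 0 <= t -> c <= / 2 - H t).
{ intros t Ht.
  assert (He := exp_pos ((1 + q0) * t)).
  enough (0 <= exp ((1 + q0) * t) * (/ 2 - c - H t)) by nra.
  apply Rle_trans with (exp ((1 + q0) * 0) * (/ 2 - c - H 0)).
  { apply Rmult_le_pos; [apply Rlt_le, exp_pos | lra]. }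
  apply (nondecreasing_of_derive (fun t => exp ((1 + q0) * t) * (/ 2 - c - H t))
    (fun t => (1 + q0) * exp ((1 + q0) * t) * (/ 2 - c - H t)
              + exp ((1 + q0) * t) * (0 - (/ 2 - H t * P t)))); auto.
  - intros x _.
    apply (is_derive_mult (fun t => exp ((1 + q0) * t)) (fun t => / 2 - c - H t)).
    + apply is_derive_exp_linear.
    + apply (is_derive_minus (fun _ => / 2 - c) H); [|apply (trajectory_H _ _ T)].
      apply is_derive_cst.
    + intros; apply Rmult_comm.
  - intros x [Hx _].
    assert (Hex := exp_pos ((1 + q0) * x)).
    assert (Hq : 1 + q0 <= P x).
    { replace (1 + q0) with (P 0) by (unfold q0; ring).
      now apply (P_nondecreasing H P T). }
    replace ((1 + q0) * exp ((1 + q0) * x) * (/ 2 - c - H x)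
              + exp ((1 + q0) * x) * (0 - (/ 2 - H x * P x)))
      with (exp ((1 + q0) * x) * ((1 + q0) * (/ 2 - c - H x) + H x * P x - / 2)) by ring.
    apply Rmult_le_pos; [lra|].
    generalize (HH x); nra. }
exists c; split; auto; intros t Ht.
enough (P 0 - c * 0 <= P t - c * t) by (generalize (HP 0); lra).
apply (nondecreasing_of_derive (fun t => P t - c * t)
  (fun t => / 2 - 2 * (H t * H t) - c)); auto.
- intros x _; apply (is_derive_minus P (fun t => c * t)); [apply (trajectory_P _ _ T)|].
  evar_last; [apply is_derive_scal; apply (@is_derive_id R_AbsRing)|].
  unfold one; simpl; ring.
- intros x [Hx _]; generalize (Ha x Hx) (HH x); nra.
Qed.

(** * The conical end *)

(** One half of L'Hopital's rule, which applies even when [u' / v'] has no limit. *)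
Lemma eventually_le_of_derive (u v u' v' : R -> R) (r k eps : R) :
  (forall t, r <= t -> is_derive u t (u' t)) ->
  (forall t, r <= t -> is_derive v t (v' t)) ->
  (forall t, r <= t -> u' t <= k * v' t) ->
  is_lim v p_infty p_infty -> 0 < eps ->
  exists M, forall t, M < t -> u t <= (k + eps) * v t.
Proof.
intros Hu Hv Hle Hlim Heps.
apply is_lim_spec in Hlim.
destruct (Hlim ((u r - k * v r) / eps)) as [M HM].
exists (Rmax r M); intros t Ht.
assert (Hr : r <= t /\ M < t).
{ generalize (Rmax_l r M) (Rmax_r r M); lra. }
specialize (HM t (proj2 Hr)).
apply Rcomplements.Rlt_div_l in HM; auto.
enough (u t - k * v t <= u r - k * v r) by lra.
apply (nonincreasing_of_derive (fun x => u x - k * v x) (fun x => u' x - k * v' x)); [lra | |].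
- intros x Hx; apply (is_derive_minus u (fun x => k * v x)); [apply Hu; lra|].
  apply (is_derive_scal v); apply Hv; lra.
- intros x Hx; generalize (Hle x (proj1 Hx)); lra.
Qed.

(** L'Hopital's rule for an infinite limit of the denominator. *)
Lemma lhopital_p_infty (u v u' v' : R -> R) (r l : R) :
  (forall t, r <= t -> is_derive u t (u' t)) ->
  (forall t, r <= t -> is_derive v t (v' t)) ->
  (forall t, r <= t -> 0 < v' t) ->
  is_lim v p_infty p_infty ->
  is_lim (fun t => u' t / v' t) p_infty l ->
  is_lim (fun t => u t / v t) p_infty l.
Proof.
intros Hu Hv Hpos Hlim Hq.
apply is_lim_spec; intros eps.
assert (Heps := cond_pos eps).
assert (Hq' := proj2 (is_lim_spec _ _ _) Hq).
destruct (Hq' (mkposreal (eps / 3) ltac:(lra))) as [N HN]; simpl in HN.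
set (s := Rmax r (N + 1)).
assert (Hs : forall t, s <= t -> r <= t /\ N < t).
{ intros t; unfold s; generalize (Rmax_l r (N + 1)) (Rmax_r r (N + 1)); lra. }
assert (Hb : forall t, s <= t -> (l - eps / 3) * v' t <= u' t <= (l + eps / 3) * v' t).
{ intros t Ht; destruct (Hs t Ht) as [H1 H2].
  specialize (HN t H2); specialize (Hpos t H1).
  apply Rcomplements.Rabs_lt_between' in HN.
  assert (E : u' t = u' t / v' t * v' t) by (field; lra).
  rewrite E; split; apply Rmult_le_compat_r; lra. }
destruct (eventually_le_of_derive u v u' v' s (l + eps / 3) (eps / 3)) as [M1 HM1];
  auto; try lra.
{ intros t Ht; apply Hu, Hs, Ht. }
{ intros t Ht; apply Hv, Hs, Ht. }
{ intros t Ht; apply Hb, Ht. }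
destruct (eventually_le_of_derive (fun t => - u t) v (fun t => - u' t) v' s
  (- (l - eps / 3)) (eps / 3)) as [M2 HM2]; auto; try lra.
{ intros t Ht; apply (is_derive_opp u), Hu, Hs, Ht. }
{ intros t Ht; apply Hv, Hs, Ht. }
{ intros t Ht; generalize (Hb t Ht); lra. }
destruct (proj2 (is_lim_spec _ _ _) Hlim 0) as [M3 HM3].
exists (Rmax M1 (Rmax M2 M3)); intros t Ht.
assert (Ht' : M1 < t /\ M2 < t /\ M3 < t).
{ generalize (Rmax_l M1 (Rmax M2 M3)) (Rmax_r M1 (Rmax M2 M3))
    (Rmax_l M2 M3) (Rmax_r M2 M3); lra. }
specialize (HM1 t ltac:(lra)); specialize (HM2 t ltac:(lra)); specialize (HM3 t ltac:(lra)).
apply Rcomplements.Rabs_lt_between'.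
split; [apply Rcomplements.Rlt_div_r | apply Rcomplements.Rlt_div_l]; nra.
Qed.

Lemma is_lim_P H P : cusp_trajectory H P -> is_lim P p_infty p_infty.
Proof.
intros T; destruct (P_linear_growth H P T) as [c [Hc HP]].
apply is_lim_spec; intros M; exists (Rmax 0 (M / c)); intros t Ht.
assert (Ht' : 0 <= t /\ M / c < t).
{ generalize (Rmax_l 0 (M / c)) (Rmax_r 0 (M / c)); lra. }
destruct Ht' as [H0 H1]; apply Rcomplements.Rlt_div_l in H1; auto.
generalize (HP t H0); lra.
Qed.

(** Because [Q < / 2], the product [H P] stays below [3 / 4], and [P] is unbounded. *)
Lemma is_lim_H H P : cusp_trajectory H P -> is_lim H p_infty 0.
Proof.
intros T.
apply (is_lim_le_le_loc (fun _ => 0) (fun t => 3 / 4 * / P t)).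
- exists 0; intros t _.
  generalize (H_strict_bounds H P T t) (P_gt_1 H P T t) (Q_bounds H P T t); unfold Q; intros.
  split; [lra|].
  apply Rmult_le_reg_r with (P t); [lra|].
  rewrite Rmult_assoc, Rinv_l by lra; nra.
- apply is_lim_const.
- evar_last.
  + apply (is_lim_scal_l (fun t => / P t) (3 / 4) p_infty).
    apply (is_lim_inv P p_infty p_infty); [now apply (is_lim_P H) | easy].
  + simpl; f_equal; ring.
Qed.

(** The defect [/ 2 - Q] satisfies [D' = - m D + H ^ 3] with [m >= / 2] and
    [H ^ 3 -> 0].  Comparing [exp (t / 2) D] with [exp (t / 2)] through their
    derivatives shows [D -> 0]. *)
Lemma is_lim_Q H P : cusp_trajectory H P -> is_lim (Q H P) p_infty (/ 2).
Proof.
intros T.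
assert (HH := H_strict_bounds H P T). assert (HP := P_gt_1 H P T).
assert (HQ := Q_bounds H P T).
apply is_lim_spec; intros eps.
assert (Heps := cond_pos eps).
destruct (proj2 (is_lim_spec _ _ _) (is_lim_H H P T) (mkposreal (eps / 2) ltac:(lra)))
  as [r Hr]; simpl in Hr.
assert (Hexp : is_lim (fun t => exp (/ 2 * t)) p_infty p_infty).
{ apply (is_lim_comp exp (fun t => / 2 * t) p_infty p_infty p_infty).
  - apply is_lim_exp_p.
  - evar_last; [apply (is_lim_scal_l (fun t => t) (/ 2) p_infty p_infty), is_lim_id|].
    simpl; destruct Rle_dec as [Hle|]; [|lra]; destruct Rle_lt_or_eq_dec; auto; lra.
  - now exists 0. }
destruct (eventually_le_of_derive
  (fun t => exp (/ 2 * t) * (/ 2 - Q H P t)) (fun t => exp (/ 2 * t))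
  (fun t => / 2 * exp (/ 2 * t) * (/ 2 - Q H P t)
            + exp (/ 2 * t) * (0 - ((P t - H t) * (/ 2 - Q H P t) - H t ^ 3)))
  (fun t => / 2 * exp (/ 2 * t)) (r + 1) (eps / 4) (eps / 4)) as [M HM]; auto; try lra.
- intros t _.
  apply (is_derive_mult (fun t => exp (/ 2 * t)) (fun t => / 2 - Q H P t)).
  + apply is_derive_exp_linear.
  + apply (is_derive_minus (fun _ => / 2) (Q H P)); [|now apply is_derive_Q].
    apply is_derive_cst.
  + intros; apply Rmult_comm.
- intros t _; apply is_derive_exp_linear.
- intros t Ht.
  assert (Hh := Hr t ltac:(lra)).
  rewrite Rminus_0_r, Rabs_pos_eq in Hh by (generalize (HH t); lra).
  assert (H3 : H t ^ 3 <= eps / 8) by (simpl; generalize (HH t); nra).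
  replace (/ 2 * exp (/ 2 * t) * (/ 2 - Q H P t)
            + exp (/ 2 * t) * (0 - ((P t - H t) * (/ 2 - Q H P t) - H t ^ 3)))
    with (exp (/ 2 * t) * (H t ^ 3 - (P t - H t - / 2) * (/ 2 - Q H P t))) by ring.
  replace (eps / 4 * (/ 2 * exp (/ 2 * t))) with (exp (/ 2 * t) * (eps / 8)) by field.
  apply Rmult_le_compat_l; [apply Rlt_le, exp_pos|].
  generalize (HH t) (HP t) (HQ t); nra.
- exists M; intros t Ht; specialize (HM t Ht).
  assert (He := exp_pos (/ 2 * t)).
  apply Rabs_lt_between; generalize (HQ t).
  enough (/ 2 - Q H P t <= eps / 2) by lra. nra.
Qed.

Lemma is_lim_P_over_t H P : cusp_trajectory H P ->
  is_lim (fun t => P t / t) p_infty (/ 2).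
Proof.
intros T.
apply (lhopital_p_infty P (fun t => t) (fun t => / 2 - 2 * (H t * H t)) (fun _ => 1) 0).
- intros t _; apply (trajectory_P _ _ T).
- intros t _; apply (@is_derive_id R_AbsRing).
- intros; lra.
- apply is_lim_id.
- apply (is_lim_ext (fun t => / 2 - 2 * (H t * H t))); [intros; field|].
  replace (Finite (/ 2)) with (Finite (/ 2 - 2 * (0 * 0))) by (f_equal; ring).
  assert (L := is_lim_H H P T).
  apply (is_lim_minus' (fun _ => / 2) (fun t => 2 * (H t * H t))); [apply is_lim_const|].
  apply (is_lim_scal_l (fun t => H t * H t) 2 p_infty (Finite (0 * 0))).
  apply (is_lim_mult H H p_infty 0 0); auto; easy.
Qed.

(** [H P = Q + H ^ 2] tends to [/ 2], and so does [P / t]. *)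
Lemma is_lim_t_times_H H P : cusp_trajectory H P ->
  is_lim (fun t => H t * t) p_infty 1.
Proof.
intros T.
assert (L := is_lim_H H P T).
apply (is_lim_ext_loc (fun t => (Q H P t + H t * H t) / (P t / t))).
- exists 0; intros t Ht; unfold Q; field; generalize (P_gt_1 H P T t); lra.
- replace (Finite 1) with (Rbar_div (Finite (/ 2 + 0 * 0)) (/ 2)) by (simpl; f_equal; field).
  apply (is_lim_div (fun t => Q H P t + H t * H t) (fun t => P t / t)).
  + apply is_lim_plus'; [now apply is_lim_Q|].
    apply (is_lim_mult H H p_infty 0 0); auto; easy.
  + now apply (is_lim_P_over_t H).
  + intros E; injection E; lra.
  + easy.
Qed.

Lemma equivalent_ln H P h : cusp_trajectory H P ->
  (forall t, is_derive h t (H t)) -> equivalent_at h (fun t => ln t) p_infty.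
Proof.
intros T Hh.
apply (lhopital_p_infty h ln H (fun t => / t) 1); auto.
- intros t Ht; apply is_derive_ln; lra.
- intros t Ht; apply Rinv_0_lt_compat; lra.
- apply is_lim_ln_p.
- apply (is_lim_ext_loc (fun t => H t * t)); [|now apply (is_lim_t_times_H H P)].
  exists 0; intros t Ht; field; lra.
Qed.

Lemma equivalent_quadratic H P f : cusp_trajectory H P ->
  (forall t, is_derive f t (2 * H t - P t)) ->
  equivalent_at f (fun t => - (t ^ 2 / 4)) p_infty.
Proof.
intros T Hf; unfold equivalent_at.
apply (is_lim_ext_loc (fun t => - f t / (t ^ 2 / 4))).
{ exists 0; intros t Ht; field; lra. }
apply (lhopital_p_infty (fun t => - f t) (fun t => t ^ 2 / 4)
  (fun t => - (2 * H t - P t)) (fun t => t / 2) 1).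
- intros t _; apply (is_derive_opp f); auto.
- intros t _; auto_derive; auto; field.
- intros t Ht; lra.
- apply is_lim_spec; intros M; exists (Rmax 4 M); intros t Ht.
  generalize (Rmax_l 4 M) (Rmax_r 4 M); intros; nra.
- apply (is_lim_ext_loc (fun t => 2 * (P t / t) - 4 * (H t * / t))).
  { exists 0; intros t Ht; field; lra. }
  replace (Finite 1) with (Finite (2 * / 2 - 4 * (0 * 0))) by (f_equal; field).
  apply is_lim_minus'.
  + apply (is_lim_scal_l (fun t => P t / t) 2 p_infty (Finite (/ 2))).
    now apply (is_lim_P_over_t H).
  + apply (is_lim_scal_l (fun t => H t * / t) 4 p_infty (Finite (0 * 0))).
    apply (is_lim_mult H Rinv p_infty 0 0); [now apply (is_lim_H H P) | | easy].
    apply (is_lim_inv (fun t => t) p_infty p_infty); [apply is_lim_id | easy].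
Qed.

(** * Smooth functions of the radial coordinate *)

(** Smoothness of the solutions of a system of differential equations: every
    iterated derivative stays in the class. *)
Lemma smooth_of_derivation_closed (C : (R -> R) -> Prop) :
  (forall u, C u -> exists u', C u' /\ forall t, is_derive u t (u' t)) ->
  forall u, C u -> smooth u.
Proof.
intros HC u Hu.
assert (E : forall n, exists v, C v /\ forall t, Derive_n u n t = v t).
{ induction n as [|n [v [Hv E]]]; [now exists u|].
  destruct (HC v Hv) as [v' [Hv' D]]; exists v'; split; auto.
  intros t; simpl; rewrite (Derive_ext _ _ _ E); apply is_derive_unique, D. }
intros [|n] t; [easy|].
destruct (E n) as [v [Hv En]]; destruct (HC v Hv) as [v' [_ D]].
apply (ex_derive_ext v); [intros; symmetry; apply En|].
eexists; apply D.
Qed.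

Lemma smooth_is_derive (u : R -> R) t : smooth u -> is_derive u t (Derive u t).
Proof. intros Hu; apply Derive_correct, (Hu 1%nat). Qed.

Lemma smooth_Derive (u : R -> R) : smooth u -> smooth (Derive u).
Proof.
intros Hu [|n] t; [easy|].
apply (ex_derive_ext (Derive_n u (S n))); [|apply (Hu (S (S n)))].
intros s; rewrite <- Nat.add_1_r; symmetry; apply (Derive_n_comp u n 1).
Qed.

Lemma smooth_const (c : R) : smooth (fun _ => c).
Proof.
apply (smooth_of_derivation_closed (fun u => exists c, u = fun _ => c)); [|now exists c].
intros u [d ->]; exists (fun _ => 0); split; [now exists 0|].
intros t; apply is_derive_cst.
Qed.

(** The functions polynomial in [h, f, H, P, exp (2 h)]; by the equations of the
    trajectory they form a differential algebra. *)
Inductive soliton_algebra (h f H P : R -> R) : (R -> R) -> Prop :=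
| alg_h : soliton_algebra h f H P h
| alg_f : soliton_algebra h f H P f
| alg_H : soliton_algebra h f H P H
| alg_P : soliton_algebra h f H P P
| alg_exp : soliton_algebra h f H P (fun t => exp (2 * h t))
| alg_const c : soliton_algebra h f H P (fun _ => c)
| alg_plus u v : soliton_algebra h f H P u -> soliton_algebra h f H P v ->
    soliton_algebra h f H P (fun t => u t + v t)
| alg_mult u v : soliton_algebra h f H P u -> soliton_algebra h f H P v ->
    soliton_algebra h f H P (fun t => u t * v t).

Ltac in_algebra :=
  match goal with
  | |- soliton_algebra _ _ _ _ (fun t => @?u t + @?v t) =>
      apply (alg_plus _ _ _ _ u v); in_algebra
  | |- soliton_algebra _ _ _ _ (fun t => @?u t * @?v t) =>
      apply (alg_mult _ _ _ _ u v); in_algebra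
  | _ => constructor
  end.

Lemma is_derive_exp_2h (h : R -> R) (t l : R) :
  is_derive h t l -> is_derive (fun s => exp (2 * h s)) t (2 * l * exp (2 * h t)).
Proof.
intros Hh; apply (is_derive_comp exp (fun s => 2 * h s)).
- apply is_derive_exp.
- now apply (is_derive_scal h).
Qed.

Lemma soliton_algebra_smooth h f H P : cusp_trajectory H P ->
  (forall t, is_derive h t (H t)) -> (forall t, is_derive f t (2 * H t - P t)) ->
  forall u, soliton_algebra h f H P u -> smooth u.
Proof.
intros T Hh Hf; apply smooth_of_derivation_closed.
assert (HH := trajectory_H _ _ T). assert (HP := trajectory_P _ _ T).
intros u Hu; induction Hu as [| | | | | c | u v Hu [u' [Cu Du]] Hv [v' [Cv Dv]]
  | u v Hu [u' [Cu Du]] Hv [v' [Cv Dv]]].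
- exists H; split; auto using alg_H.
- exists (fun t => 2 * H t + (-1) * P t); split; [in_algebra|].
  intros t; replace (2 * H t + -1 * P t) with (2 * H t - P t) by ring; auto.
- exists (fun t => / 2 + (-1) * (H t * P t)); split; [in_algebra|].
  intros t; replace (/ 2 + -1 * (H t * P t)) with (/ 2 - H t * P t) by ring; auto.
- exists (fun t => / 2 + (-2) * (H t * H t)); split; [in_algebra|].
  intros t; replace (/ 2 + -2 * (H t * H t)) with (/ 2 - 2 * (H t * H t)) by ring; auto.
- exists (fun t => 2 * H t * exp (2 * h t)); split; [in_algebra|].
  intros t; now apply is_derive_exp_2h.
- exists (fun _ => 0); split; auto using alg_const.
  intros t; apply is_derive_cst.
- exists (fun t => u' t + v' t); split; auto using alg_plus.
  intros t; now apply (is_derive_plus u v).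
- exists (fun t => u' t * v t + u t * v' t); split; [apply alg_plus; now apply alg_mult|].
  intros t; apply (is_derive_mult u v); auto. intros; apply Rmult_comm.
Qed.

Lemma pd_radial (i : coord) (phi phi' : R -> R) :
  (forall t, is_derive phi t (phi' t)) ->
  pd i (radial phi) = radial (match i with Cr => phi' | _ => fun _ => 0 end).
Proof.
intros Hphi; apply functional_extensionality; intros [[r x] y].
destruct i; unfold pd, radial; simpl.
- apply is_derive_unique, Hphi.
- apply Derive_const.
- apply Derive_const.
Qed.

Lemma ex_pd_radial (i : coord) (phi : R -> R) p :
  (forall t, ex_derive phi t) -> ex_pd i (radial phi) p.
Proof.
intros Hphi; destruct p as [[r x] y].
destruct i; unfold ex_pd, radial; simpl; auto; apply ex_derive_const.
Qed.

Lemma continuous_radial (phi : R -> R) p :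
  (forall t, continuous phi t) -> continuous (radial phi) p.
Proof.
intros Hphi.
apply (continuous_ext (fun q : point => phi (fst (fst q)))).
{ now intros [[r x] y]. }
apply (continuous_comp (fun q : point => fst (fst q)) phi); auto.
apply (continuous_comp (fun q : point => fst q) fst); apply continuous_fst.
Qed.

(** Iterated partial derivatives of a radial function are again radial. *)
Lemma smooth_on_radial G (phi : R -> R) : smooth phi -> smooth_on G (radial phi).
Proof.
intros Hphi; split; [|now intros r x y s t _ _].
intros l.
assert (E : exists psi, smooth psi /\ fold_right pd (radial phi) l = radial psi).
{ induction l as [|i l [psi [Hpsi E]]]; [now exists phi|].
  simpl; rewrite E, (pd_radial i psi (Derive psi)).
  - exists (match i with Cr => Derive psi | _ => fun _ => 0 end); split; auto.
    destruct i; auto using smooth_Derive, smooth_const.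
  - intros t; now apply smooth_is_derive. }
destruct E as [psi [Hpsi E]]; intros p; rewrite E; split.
- apply continuous_radial; intros t.
  apply (continuous_of_derive _ _ _ (smooth_is_derive psi t Hpsi)).
- intros i; apply ex_pd_radial; intros t; apply (Hpsi 1%nat).
Qed.

(** * Curvature of the warped product *)

Lemma riemannian_metric_warped G h : smooth (fun t => exp (2 * h t)) ->
  riemannian_metric G (warped_metric h).
Proof.
intros Hh; split; [|split].
- intros i j; destruct i, j;
    try apply (smooth_on_radial G (fun _ => 1) (smooth_const 1));
    try apply (smooth_on_radial G (fun _ => 0) (smooth_const 0));
    apply (smooth_on_radial G _ Hh).
- now intros [] [] p.
- intros p u [i Hi]; unfold eval2, sum3; simpl.
  assert (He := exp_pos (2 * h (get Cr p))).
  set (E := exp (2 * h (get Cr p))) in *.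
  assert (0 <= E * (u Cx * u Cx)) by (apply Rmult_le_pos; nra).
  assert (0 <= E * (u Cy * u Cy)) by (apply Rmult_le_pos; nra).
  assert (Hpos : 0 < u i * u i) by (apply Rlt_0_sqr; auto).
  destruct i.
  + nra.
  + assert (0 < E * (u Cx * u Cx)) by (apply Rmult_lt_0_compat; nra). nra.
  + assert (0 < E * (u Cy * u Cy)) by (apply Rmult_lt_0_compat; nra). nra.
Qed.

Definition warped_christoffel (h H : R -> R) (k i j : coord) : R -> R :=
  match k, i, j with
  | Cr, Cx, Cx | Cr, Cy, Cy => fun t => - (H t * exp (2 * h t))
  | Cx, Cr, Cx | Cx, Cx, Cr | Cy, Cr, Cy | Cy, Cy, Cr => H
  | _, _, _ => fun _ => 0
  end.

(** The radial derivative of [warped_christoffel]. *)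
Definition warped_christoffel' (h H H' : R -> R) (k i j : coord) : R -> R :=
  match k, i, j with
  | Cr, Cx, Cx | Cr, Cy, Cy =>
      fun t => - ((H' t + 2 * (H t * H t)) * exp (2 * h t))
  | Cx, Cr, Cx | Cx, Cx, Cr | Cy, Cr, Cy | Cy, Cy, Cr => H'
  | _, _, _ => fun _ => 0
  end.

Lemma is_derive_warped_christoffel h H H' k i j t :
  (forall t, is_derive h t (H t)) -> (forall t, is_derive H t (H' t)) ->
  is_derive (warped_christoffel h H k i j) t (warped_christoffel' h H H' k i j t).
Proof.
intros Hh HH.
assert (Hz : is_derive (fun _ : R => 0) t 0)
  by apply is_derive_cst.
assert (Hg : is_derive (fun t => - (H t * exp (2 * h t))) t
  (- ((H' t + 2 * (H t * H t)) * exp (2 * h t)))).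
{ apply (is_derive_opp (fun t => H t * exp (2 * h t))).
  evar_last.
  - apply (is_derive_mult H (fun t => exp (2 * h t))).
    + apply HH.
    + apply is_derive_exp_2h, Hh.
    + intros; apply Rmult_comm.
  - unfold plus, mult; simpl; ring. }
destruct k, i, j; simpl; auto.
Qed.

Lemma pd_warped_metric h H l i j : (forall t, is_derive h t (H t)) ->
  pd l (warped_metric h i j) = radial
    match l, i, j with
    | Cr, Cx, Cx | Cr, Cy, Cy => fun t => 2 * H t * exp (2 * h t)
    | _, _, _ => fun _ => 0
    end.
Proof.
intros Hh.
assert (H0 : forall c : R, pd l (radial (fun _ => c)) = radial (fun _ => 0)).
{ intros c; rewrite (pd_radial l _ (fun _ => 0)); [now destruct l|].
  intros t; apply is_derive_cst. }
assert (HE := pd_radial l _ _ (fun t => is_derive_exp_2h h t _ (Hh t))).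
destruct i, j; try (etransitivity; [apply (H0 0)|]; now destruct l).
- etransitivity; [apply (H0 1)|]; now destruct l.
- etransitivity; [apply HE|]; now destruct l.
- etransitivity; [apply HE|]; now destruct l.
Qed.

Lemma christoffel_warped h H k i j : (forall t, is_derive h t (H t)) ->
  christoffel (warped_metric h) k i j = radial (warped_christoffel h H k i j).
Proof.
intros Hh; apply functional_extensionality; intros p.
assert (He := exp_pos (2 * h (get Cr p))).
unfold christoffel, sum3.
rewrite !(pd_warped_metric h H) by exact Hh.
unfold radial, inverse, det, sum3, cofactor.
destruct k, i, j; simpl; field; lra.
Qed.

(** The sectional curvature of the coordinate plane [(i, j)], for [i <> j]. *)
Definition plane_curvature (H H' : R -> R) (i j : coord) (t : R) : R :=
  match i, j with
  | Cr, _ | _, Cr => - (H' t + H t * H t)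
  | _, _ => - (H t * H t)
  end.

Definition kronecker (i j : coord) : R :=
  match i, j with Cr, Cr | Cx, Cx | Cy, Cy => 1 | _, _ => 0 end.

(** The coordinate planes diagonalize the curvature operator, so each
    [R(d_i, d_j)] is that of a space of constant curvature
    [plane_curvature i j]. *)
Lemma riemann_warped h H H' l i j k p :
  (forall t, is_derive h t (H t)) -> (forall t, is_derive H t (H' t)) ->
  riemann (warped_metric h) l i j k p =
  plane_curvature H H' i j (get Cr p) *
  (warped_metric h j k p * kronecker l i - warped_metric h i k p * kronecker l j).
Proof.
intros Hh HH.
unfold riemann, sum3; rewrite !(christoffel_warped h H) by exact Hh.
rewrite !(fun i l j k => pd_radial i _ _
  (fun t => is_derive_warped_christoffel h H H' l j k t Hh HH)).
unfold radial; destruct l, i, j, k; simpl; ring.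
Qed.

Lemma ricci_warped h H H' i j p :
  (forall t, is_derive h t (H t)) -> (forall t, is_derive H t (H' t)) ->
  ricci (warped_metric h) i j p =
  match i, j with
  | Cr, Cr => - 2 * (H' (get Cr p) + H (get Cr p) * H (get Cr p))
  | Cx, Cx | Cy, Cy =>
      - (H' (get Cr p) + 2 * (H (get Cr p) * H (get Cr p))) * exp (2 * h (get Cr p))
  | _, _ => 0
  end.
Proof.
intros Hh HH; unfold ricci, sum3; rewrite !(riemann_warped h H H') by auto.
destruct i, j; simpl; ring.
Qed.

Lemma hessian_radial h H f F F' i j p :
  (forall t, is_derive h t (H t)) ->
  (forall t, is_derive f t (F t)) -> (forall t, is_derive F t (F' t)) ->
  hessian (warped_metric h) (radial f) i j p =
  match i, j with
  | Cr, Cr => F' (get Cr p)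
  | Cx, Cx | Cy, Cy => H (get Cr p) * F (get Cr p) * exp (2 * h (get Cr p))
  | _, _ => 0
  end.
Proof.
intros Hh Hf HF; unfold hessian, sum3.
rewrite !(christoffel_warped h H) by exact Hh.
rewrite !(fun i => pd_radial i f F Hf).
assert (H0 : forall l, pd l (radial (fun _ => 0)) = radial (fun _ => 0)).
{ intros l; rewrite (pd_radial l _ (fun _ => 0)); [now destruct l|].
  intros t; apply is_derive_cst. }
destruct i, j; rewrite ?(pd_radial _ F F' HF), ?H0;
  unfold radial; simpl; ring.
Qed.

(** The curvature operator being diagonal, the sectional curvature of any plane is
    the average of the curvatures of the coordinate planes, with weights proportional
    to the squared Plucker coordinates of the plane in an orthonormal frame.  The
    [(r, x)] and [(r, y)] planes have the same curvature, so two weights remain. *)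
Lemma sec_warped h H H' p u v :
  (forall t, is_derive h t (H t)) -> (forall t, is_derive H t (H' t)) ->
  independent u v ->
  exists rho sigma, 0 <= rho /\ 0 <= sigma /\ rho + sigma = 1 /\
  sec (warped_metric h) p u v =
    rho * - (H' (get Cr p) + H (get Cr p) * H (get Cr p))
    + sigma * - (H (get Cr p) * H (get Cr p)).
Proof.
intros Hh HH Huv.
set (E := exp (2 * h (get Cr p))).
assert (HE : 0 < E) by apply exp_pos.
set (w := fun i j => u i * v j - u j * v i).
set (A := E * (w Cr Cx * w Cr Cx + w Cr Cy * w Cr Cy)).
set (B := E * E * (w Cx Cy * w Cx Cy)).
assert (HA : 0 <= A) by (unfold A; apply Rmult_le_pos; nra).
assert (HB : 0 <= B) by (unfold B; apply Rmult_le_pos; nra).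
assert (HAB : 0 < A + B).
{ destruct (Rle_lt_or_eq_dec 0 (A + B) ltac:(lra)) as [|Z]; auto; exfalso.
  assert (ZA : A = 0) by lra. assert (ZB : B = 0) by lra.
  unfold A in ZA; apply Rmult_integral in ZA; destruct ZA as [ZA|ZA]; [lra|].
  unfold B in ZB; apply Rmult_integral in ZB; destruct ZB as [ZB|ZB]; [nra|].
  assert (W1 : w Cr Cx = 0) by nra. assert (W2 : w Cr Cy = 0) by nra.
  assert (W3 : w Cx Cy = 0) by nra. clearbody A B; clear ZA ZB.
  assert (W : forall i j, u i * v j = u j * v i).
  { unfold w in *; intros [] []; lra. }
  assert (Hv : forall j, v j = 0).
  { intros j; destruct (Huv (v j) (- u j)) as [H1 _]; auto.
    intros i; generalize (W i j); lra. }
  destruct (Huv 0 1) as [_ H1]; [|lra].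
  intros i; rewrite (Hv i); ring. }
exists (A / (A + B)), (B / (A + B)).
split; [apply Rcomplements.Rdiv_le_0_compat; lra|].
split; [apply Rcomplements.Rdiv_le_0_compat; lra|].
split; [field; lra|].
assert (Den : eval2 (warped_metric h) p u u * eval2 (warped_metric h) p v v
  - (eval2 (warped_metric h) p u v) ^ 2 = A + B).
{ unfold eval2, sum3; simpl; fold E; unfold A, B, w; ring. }
assert (Num : eval2 (warped_metric h) p (curvature (warped_metric h) p u v v) u =
  A * - (H' (get Cr p) + H (get Cr p) * H (get Cr p)) + B * - (H (get Cr p) * H (get Cr p))).
{ unfold eval2, curvature, sum3.
  rewrite !(riemann_warped h H H') by auto.
  simpl; fold E; unfold A, B, w; ring. }
unfold sec; rewrite Den, Num; field; lra.
Qed.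

Lemma sec_bounds H P h p u v : cusp_trajectory H P ->
  (forall t, is_derive h t (H t)) -> independent u v ->
  - / 4 < sec (warped_metric h) p u v < 0.
Proof.
intros T Hh Huv.
destruct (sec_warped h H _ p u v Hh (trajectory_H _ _ T) Huv)
  as [rho [sigma [Hr [Hs [E ->]]]]].
set (r := get Cr p).
generalize (H_strict_bounds H P T r) (Q_bounds H P T r); unfold Q; intros HH HQ.
set (k1 := / 2 - H r * P r + H r * H r).
assert (0 < k1 < / 4) by (unfold k1; lra).
set (k2 := H r * H r) in *.
assert (0 < k2 < / 4) by (unfold k2; nra).
replace sigma with (1 - rho) in * by lra.
assert (Hmean : forall x y, 0 < x -> 0 < y -> 0 < rho * x + (1 - rho) * y).
{ intros x y Hx Hy; destruct (Rle_dec (/ 2) rho); nra. }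
generalize (Hmean k1 k2) (Hmean (/ 4 - k1) (/ 4 - k2)); lra.
Qed.

(** * The soliton *)

(** At the cusp [h' - / 2] and [f'] are [O (mode)], hence integrable: the
    constants of integration are chosen so that [h - t / 2] and [f] tend to [0]
    there. *)
Lemma cusp_potentials H P : cusp_trajectory H P ->
  exists h f, (forall t, is_derive h t (H t)) /\
    (forall t, is_derive f t (2 * H t - P t)) /\
    exists K, forall t, Rabs (h t - t / 2) <= K * mode t /\ Rabs (f t) <= K * mode t.
Proof.
intros T.
assert (Hl := lambda_bounds).
assert (HHc : forall t, continuous H t).
{ intros t; apply (continuous_of_derive _ _ _ (trajectory_H _ _ T t)). }
assert (HPc : forall t, continuous P t).
{ intros t; apply (continuous_of_derive _ _ _ (trajectory_P _ _ T t)). }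
destruct (decaying_solution (fun _ => 0) (fun t => / 2 - H t) 0 lambda 1)
  as [A [HA HA']]; try (intros; lra).
{ intros t; apply continuous_const. }
{ intros t; apply (continuous_minus (fun _ => / 2) H); auto; apply continuous_const. }
{ intros t; generalize (trajectory_H_bounds _ _ T t) (trajectory_H_decay _ _ T t); unfold mode;
    intros; rewrite Rabs_pos_eq; lra. }
destruct (decaying_solution (fun _ => 0) (fun t => P t - 1) 0 lambda (2 / lambda))
  as [B [HB HB']]; try (intros; lra).
{ intros t; apply continuous_const. }
{ intros t; apply (continuous_minus P (fun _ => 1)); auto; apply continuous_const. }
{ intros t; generalize (trajectory_P_decay _ _ T t); unfold mode;
    intros; rewrite Rabs_pos_eq; lra. }
rewrite Rplus_0_r in HA', HB'.
exists (fun t => / 2 * t - A t), (fun t => - (2 * A t + B t)); split; [|split].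
- intros t; evar_last.
  + apply (is_derive_minus (fun t => / 2 * t) A); [|apply HA].
    apply is_derive_scal, (@is_derive_id R_AbsRing).
  + unfold minus, plus, opp, one; simpl; ring.
- intros t; evar_last.
  + apply (is_derive_opp (fun t => 2 * A t + B t)), (is_derive_plus (fun t => 2 * A t) B);
      [apply is_derive_scal, HA | apply HB].
  + unfold plus, opp; simpl; field.
- set (k1 := 1 / lambda) in *. set (k2 := 2 / lambda / lambda) in *.
  exists (2 * k1 + k2); intros t.
  specialize (HA' t); specialize (HB' t); fold (mode t) in HA', HB'.
  assert (Hz := mode_pos t).
  assert (0 <= k1 * mode t) by (generalize (Rabs_pos (A t)); lra).
  assert (0 <= k2 * mode t) by (generalize (Rabs_pos (B t)); lra).
  apply Rabs_le_between in HA'; apply Rabs_le_between in HB'.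
  split; apply Rabs_le_between; lra.
Qed.

Lemma is_lim_of_exp_bound (u : R -> R) (K : R) :
  (forall t, Rabs (u t) <= K * mode t) -> is_lim u m_infty 0.
Proof.
intros Hu; apply is_lim_spec; intros eps.
assert (Heps := cond_pos eps).
destruct (exp_linear_small K lambda (eps / 2)) as [M HM];
  [generalize lambda_bounds; lra | lra |].
exists M; intros t Ht; rewrite Rminus_0_r.
eapply Rle_lt_trans; [apply Hu|].
specialize (HM t (Rlt_le _ _ Ht)); fold (mode t) in HM; lra.
Qed.

Lemma equivalent_cusp (h : R -> R) (K : R) :
  (forall t, Rabs (h t - t / 2) <= K * mode t) ->
  equivalent_at h (fun t => t / 2) m_infty.
Proof.
intros Hh; unfold equivalent_at.
apply (is_lim_ext_loc (fun t => 1 + 2 * ((h t - t / 2) * / t))).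
{ exists 0; intros t Ht; field; lra. }
replace (Finite 1) with (Finite (1 + 2 * (0 * 0))) by (f_equal; ring).
apply (is_lim_plus' (fun _ => 1)); [apply is_lim_const|].
apply (is_lim_scal_l (fun t => (h t - t / 2) * / t) 2 m_infty (Finite (0 * 0))).
apply (is_lim_mult (fun t => h t - t / 2) Rinv m_infty 0 0); [| | easy].
- now apply (is_lim_of_exp_bound _ K).
- apply (is_lim_inv (fun t => t) m_infty m_infty); [apply is_lim_id | easy].
Qed.

Theorem theorem1p1 :
  forall G : R -> Prop, circle_group G ->
  exists h f : R -> R,
    smooth h /\ smooth f /\
    expanding_soliton G (warped_metric h) (radial f) /\
    (forall (p : point) (u v : vector), independent u v ->
       - / 4 < sec (warped_metric h) p u v < 0) /\
    (equivalent_at h (fun r => r / 2) m_infty /\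
     exists c : R, is_lim f m_infty (Finite c)) /\
    (equivalent_at h (fun r => ln r) p_infty /\
     equivalent_at f (fun r => - (r ^ 2 / 4)) p_infty).
Proof.
intros G _.
destruct cusp_trajectory_exists as [H [P T]].
destruct (cusp_potentials H P T) as [h [f [Hh [Hf [K HK]]]]].
assert (Smooth := soliton_algebra_smooth h f H P T Hh Hf).
assert (HH := trajectory_H _ _ T). assert (HP := trajectory_P _ _ T).
assert (HF : forall t, is_derive (fun t => 2 * H t - P t) t
  (2 * (/ 2 - H t * P t) - (/ 2 - 2 * (H t * H t)))).
{ intros t; apply (is_derive_minus (fun t => 2 * H t) P); auto.
  now apply (is_derive_scal H). }
exists h, f; split; [|split; [|split; [|split; [|split; split]]]].
- apply Smooth, alg_h.
- apply Smooth, alg_f.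
- split; [|split].
  + apply riemannian_metric_warped, Smooth, alg_exp.
  + apply smooth_on_radial, Smooth, alg_f.
  + intros i j p.
    rewrite (ricci_warped h H _ i j p Hh HH), (hessian_radial h H f _ _ i j p Hh Hf HF).
    destruct i, j; simpl; field.
- intros p u v Huv; now apply (sec_bounds H P).
- apply (equivalent_cusp h K), HK.
- exists 0; apply (is_lim_of_exp_bound f K), HK.
- now apply (equivalent_ln H P).
- now apply (equivalent_quadratic H P).
Qed.
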